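(* Let $h,\tau,\hbar,\rho_\infty,B_\infty>0$ and $V_\infty\in\mathbb{R}$. The operator $\mathcal{S}_D$ of the semi-discrete transparent boundary condition and the operator $\mathcal{S}_{\mathrm{ref}\,1/4}$ of the discrete transparent boundary condition for $\theta=\frac14$ (both defined in the context) coincide.
   Context: Time mesh: $t_m=m\tau$, $m\geq0$; $\overline{\partial}_tY^m=\frac{Y^m-Y^{m-1}}{\tau}$ and $\overline{s}_tY^m=\frac{Y^{m-1}+Y^m}{2}$ for $m\geq1$. Both operators act on functions $\Phi:\{t_m\}_{m\geq0}\to\mathbb{C}$ with $\Phi^0=0$ and produce functions of $m\geq1$; $\mathbf{\Phi}^m=\{\Phi^l\}_{l=1}^m$. Setting. The generalized Schrödinger equation $i\hbar\rho D_t\psi=-\frac{\hbar^2}{2}D(BD\psi)+V\psi$ on the half-axis $x>0$ has constant coefficients $\rho=\rho_\infty$, $B=B_\infty$, $V=V_\infty$ and zero initial function for $x\geq X_0$; a point $X>X_0$ is fixed, and $D=\frac{\partial}{\partial x}$. Semi-discrete transparent boundary condition (SDTBC). The semi-discrete Crank-Nicolson method takes, for $x\geq X_0$, the form $$i\hbar\rho_\infty\overline{\partial}_t\Psi^m=-\frac{\hbar^2}{2}B_\infty D^2\overline{s}_t\Psi^m+V_\infty\overline{s}_t\Psi^m,\quad m\geq1,\qquad \Psi^0(x)=0,\qquad \Psi^m(x)\to0\ \text{as}\ x\to+\infty .$$ The operator $\mathcal{S}_D$ is the one for which $(D\overline{s}_t\Psi)^m|_{x=X}=\mathcal{S}_D^m\mathbf{\Psi}_X^m$,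 $m\geq1$, holds for its solutions, where $\Psi_X^m=\Psi^m(X)$. That is: given $\Phi$ with $\Phi^0=0$, take the solution $\Psi^m(x)$, $x\geq X$, of the problem $i\hbar\rho_\infty\overline{\partial}_t\Psi^m=-\frac{\hbar^2}{2}B_\infty D^2\overline{s}_t\Psi^m+V_\infty\overline{s}_t\Psi^m$ for $x\geq X$ and $m\geq1$, $\Psi^0(x)=0$ for $x\geq X$, $\Psi^m(x)\to0$ as $x\to+\infty$ for $m\geq1$, with $\Psi^m(X)=\Phi^m$; then $\mathcal{S}_D^m\mathbf{\Phi}^m:=(D\overline{s}_t\Psi)^m(X)$. It is written as a discrete convolution $\mathcal{S}_D\mathbf{\Phi}=c_{0D}\,R_D*\Phi$, i.e. $c_{0D}\sum_{l=0}^mR_D^l\Phi^{m-l}$, normalized by $R_D^0=1$. Discrete transparent boundary condition (DTBC) for $\theta=\frac14$. On a space mesh with $x_J=X$ and constant step $h=x_j-x_{j-1}\leq X-X_0$ for $j\geq J$, the finite-difference scheme at nodes $j\geq J$ is $$i\hbar\rho_\infty\,C_\theta\overline{\partial}_t\Psi_j^m=-\frac{\hbar^2}{2}B_\infty\,\frac{\overline{s}_t\Psi_{j+1}^m-2\overline{s}_t\Psi_j^m+\overline{s}_t\Psi_{j-1}^m}{h^2}+V_\infty C_\theta\overline{s}_t\Psi_j^m,\qquad j\geq J,\ m\geq1,$$ with $C_\theta W_j:=\theta W_{j-1}+(1-2\theta)W_j+\theta W_{j+1}$ and $\Psi_j^0=0$ for $j\geq J-1$. The operator $\mathcal{S}_{\mathrm{ref}\,\theta}$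 is the one for which $$\frac{\hbar^2}{2}B_\infty\,\frac{\overline{s}_t\Psi_J^m-\overline{s}_t\Psi_{J-1}^m}{h}-h\,s^-_{x\theta}\left(i\hbar\rho_\infty\overline{\partial}_t\Psi-V_\infty\overline{s}_t\Psi\right)_J^m=\frac{\hbar^2}{2}B_\infty\,\mathcal{S}_{\mathrm{ref}\,\theta}^m\mathbf{\Psi}_J^m,\quad m\geq1,$$ with $s^-_{x\theta}W_J:=\theta W_{J-1}+\left(\frac12-\theta\right)W_J$, is the exact boundary condition satisfied at $x_J$ by the decaying solutions. That is: given $\Phi$ with $\Phi^0=0$, take the solution of the scheme for $j\geq J$ with $\Psi_j^0=0$ for $j\geq J-1$, $\Psi_J^m=\Phi^m$ and $\sum_{j\geq J}|\Psi_j^m|^2<\infty$ for every $m$; then $\mathcal{S}_{\mathrm{ref}\,\theta}^m\mathbf{\Phi}^m$ is $\frac{2}{\hbar^2B_\infty}$ times the left-hand side. Here $\theta=\frac14$. *)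

(* Defs.v *)
From Stdlib Require Export Reals.
From Coquelicot Require Export Coquelicot.

Open Scope C_scope.

Definition dbar_t (tau : R) (Y : nat -> C) (m : nat) : C :=
  (Y m - Y (m - 1)%nat) / tau.

Definition sbar_t (Y : nat -> C) (m : nat) : C :=
  (Y (m - 1)%nat + Y m) / 2.

(* Derivative at [x] of [f : [X, +oo[ -> C], one-sided at [x = X]; the values
   of [f] on the left of [X] play no role. *)
Definition is_derive_from (X : R) (f : R -> C) (x : R) (l : C) : Prop :=
  filterlim (fun y : R => (f y - f x) / (y - x)%R)
    (within (fun y : R => (X <= y)%R) (locally' x)) (locally l).

Definition is_SDTBC_solution (hbar rho B V tau X : R)
    (Phi : nat -> C) (Psi : nat -> R -> C) : Prop :=
  (forall m : nat, (1 <= m)%nat ->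
     exists DW D2W : R -> C, forall x : R, (X <= x)%R ->
       is_derive_from X (fun y => sbar_t (fun k => Psi k y) m) x (DW x) /\
       is_derive_from X DW x (D2W x) /\
       Ci * hbar * rho * dbar_t tau (fun k => Psi k x) m
       = - (hbar ^ 2 / 2)%R * B * D2W x + V * sbar_t (fun k => Psi k x) m) /\
  (forall x : R, (X <= x)%R -> Psi 0%nat x = 0) /\
  (forall m : nat, (1 <= m)%nat ->
     filterlim (Psi m) (Rbar_locally p_infty) (locally (0 : C))) /\
  (forall m : nat, (1 <= m)%nat -> Psi m X = Phi m).

(* [S Phi m] stands for S^m (Phi^1, ..., Phi^m). The first conjunct asks the
   problem to be solvable and the second its flux not to depend on the solution
   chosen, so [S] is determined for [Phi 0 = 0] and [m >= 1]. *)
Definition is_SDTBC_operator (hbar rho B V tau X : R)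
    (S : (nat -> C) -> nat -> C) : Prop :=
  forall Phi : nat -> C, Phi 0%nat = 0 ->
    (exists Psi, is_SDTBC_solution hbar rho B V tau X Phi Psi) /\
    (forall Psi, is_SDTBC_solution hbar rho B V tau X Phi Psi ->
       forall m : nat, (1 <= m)%nat ->
         is_derive_from X (fun y => sbar_t (fun k => Psi k y) m) X (S Phi m)).

Definition C_av (theta : R) (W : nat -> C) (j : nat) : C :=
  theta * W (j - 1)%nat + (1 - 2 * theta)%R * W j + theta * W (j + 1)%nat.

Definition s_minus (theta : R) (W : nat -> C) (j : nat) : C :=
  theta * W (j - 1)%nat + (1 / 2 - theta)%R * W j.

(* Only the nodes [j >= J - 1] are constrained; [J >= 1] is assumed throughout,
   so that the subtraction in [J - 1] is not truncated. *)
Definition is_DTBC_solution (hbar rho B V tau h theta : R) (J : nat)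
    (Phi : nat -> C) (Psi : nat -> nat -> C) : Prop :=
  (forall m j : nat, (1 <= m)%nat -> (J <= j)%nat ->
     let dPsi i := dbar_t tau (fun k => Psi k i) m in
     let sPsi i := sbar_t (fun k => Psi k i) m in
     Ci * hbar * rho * C_av theta dPsi j
     = - (hbar ^ 2 / 2)%R * B *
         ((sPsi (j + 1)%nat - 2 * sPsi j + sPsi (j - 1)%nat) / (h ^ 2)%R)
       + V * C_av theta sPsi j) /\
  (forall j : nat, (J - 1 <= j)%nat -> Psi 0%nat j = 0) /\
  (forall m : nat, (1 <= m)%nat -> Psi m J = Phi m) /\
  (forall m : nat, ex_series (fun k : nat => (Cmod (Psi m (J + k)%nat) ^ 2)%R)).

Definition DTBC_flux (hbar rho B V tau h theta : R) (J : nat)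
    (Psi : nat -> nat -> C) (m : nat) : C :=
  let dPsi i := dbar_t tau (fun k => Psi k i) m in
  let sPsi i := sbar_t (fun k => Psi k i) m in
  (hbar ^ 2 / 2)%R * B * ((sPsi J - sPsi (J - 1)%nat) / h)
  - h * s_minus theta (fun i => Ci * hbar * rho * dPsi i - V * sPsi i) J.

Definition is_DTBC_operator (hbar rho B V tau h theta : R) (J : nat)
    (S : (nat -> C) -> nat -> C) : Prop :=
  forall Phi : nat -> C, Phi 0%nat = 0 ->
    (exists Psi, is_DTBC_solution hbar rho B V tau h theta J Phi Psi) /\
    (forall Psi, is_DTBC_solution hbar rho B V tau h theta J Phi Psi ->
       forall m : nat, (1 <= m)%nat ->
         S Phi m = (2 / (hbar ^ 2 * B))%R
                   * DTBC_flux hbar rho B V tau h theta J Psi m).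

(* Main.v *)
From Stdlib Require Import Lia Lra Factorial FunctionalExtensionality.
Require Import Defs.

(* Encode a sequence [Y m] by its generating function, a formal power series in
   the time shift. Both schemes then become [D^2 Psi = mu^2 Psi] and
   [Psi_{j+1} - 2 Psi_j + Psi_{j-1} = (h mu / 2)^2 (Psi_{j+1} + 2 Psi_j + Psi_{j-1})]
   for one and the same power series [mu^2], whose constant coefficient is not
   real; let [mu] be the root with [Re mu_0 > 0]. The decaying solutions are
   [exp (- mu (x - X)) Phi] and [nu ^ (j - J) Phi], where the scheme for
   [theta = 1/4] is the perfect square [((1 - nu) / (1 + nu))^2 = (h mu / 2)^2],
   so that [nu = (1 - h mu / 2) / (1 + h mu / 2)] is rational in [mu].
   In both cases the flux is [- (1 + shift) / 2 * mu * Phi]. *)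

(** * Formal power series *)

(** Both operators are defined through all solutions of their problems, so exhibiting a decaying
    wave is not enough: the flux of an arbitrary solution has to be computed. Uniqueness is proved
    level by level in time. Once two solutions agree at level m - 1, their difference at level m
    obeys a homogeneous equation in which only the number mu_0 occurs, so a scalar argument
    suffices. Positivity of rho makes Im (mu_0^2) = - 4 rho / (hbar B tau) nonzero, and this serves
    twice: it yields a root with Re mu_0 > 0, and it excludes h mu_0 / 2 = 1, where nu would not be
    invertible and the value at node J - 1 could not be recovered from the one at J. No convergence
    in the time variable is needed. Decay in space is decided by the constant coefficients of mu and
    nu; higher coefficients only contribute polynomial factors. *)

Definition fps := nat -> C.

Definition fzero : fps := fun _ => 0.
Definition fcst (c : C) : fps := fun n => match n with O => c | S _ => 0 end.
Definition fadd (a b : fps) : fps := fun n => a n + b n.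
Definition fopp (a : fps) : fps := fun n => - a n.
Definition fsub (a b : fps) : fps := fun n => a n - b n.
Definition fshift (a : fps) : fps := fun n => a (S n).

(** The Cauchy product, by recursion along the left factor rather than as a finite sum, so that the
    ring laws follow by induction on the index with that factor generalized. *)
Fixpoint conv (a b : fps) (n : nat) : C :=
  match n with
  | O => a O * b O
  | S n' => a O * b n + conv (fshift a) b n'
  end.
Definition fmul (a b : fps) : fps := conv a b.

Lemma conv_ext (a a' b b' : fps) (n : nat) :
  (forall k, (k <= n)%nat -> a k = a' k) ->
  (forall k, (k <= n)%nat -> b k = b' k) -> conv a b n = conv a' b' n.
Proof.
  revert a a'; induction n as [|n IH]; intros a a' Ha Hb; simpl.
  - rewrite Ha, Hb by lia; reflexivity.
  - rewrite Ha, Hb by lia; f_equal.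
    apply IH; intros k Hk; [apply Ha | apply Hb]; lia.
Qed.

Lemma conv_zero_l (b : fps) (n : nat) : conv fzero b n = 0.
Proof.
  induction n as [|n IH]; simpl; [|change (fshift fzero) with fzero; rewrite IH];
    unfold fzero; ring.
Qed.

Lemma conv_zero_r (a b : fps) (n : nat) :
  (forall k, (k <= n)%nat -> b k = 0) -> conv a b n = 0.
Proof.
  revert a; induction n as [|n IH]; intros a H; simpl.
  - rewrite H by lia; ring.
  - rewrite IH by (intros; apply H; lia); rewrite H by lia; ring.
Qed.

Lemma conv_fcst (c : C) (b : fps) (n : nat) : conv (fcst c) b n = c * b n.
Proof.
  destruct n as [|n]; [reflexivity|].
  simpl; change (fshift (fcst c)) with fzero; rewrite conv_zero_l; ring.
Qed.

Lemma conv_add_l (a b c : fps) (n : nat) :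
  conv (fadd a b) c n = conv a c n + conv b c n.
Proof.
  revert a b; induction n as [|n IH]; intros a b; simpl.
  - unfold fadd; ring.
  - change (fshift (fadd a b)) with (fadd (fshift a) (fshift b)).
    rewrite IH; unfold fadd; ring.
Qed.

Lemma conv_scale_l (z : C) (a b : fps) (n : nat) :
  conv (fun k => z * a k) b n = z * conv a b n.
Proof.
  revert a; induction n as [|n IH]; intros a; simpl; [ring|].
  change (fshift (fun k => z * a k)) with (fun k => z * fshift a k).
  rewrite IH; ring.
Qed.

(** Peeling the constant coefficient off the right factor instead of the left one turns
    commutativity into a direct induction. *)
Lemma conv_S_r (a b : fps) (n : nat) :
  conv a b (S n) = conv a (fshift b) n + a (S n) * b O.
Proof.
  revert a; induction n as [|n IH]; intros a; [reflexivity|].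
  change (conv a b (S (S n)))
    with (a O * b (S (S n)) + conv (fshift a) b (S n)).
  rewrite IH; simpl; unfold fshift; ring.
Qed.

Lemma conv_comm (a b : fps) (n : nat) : conv a b n = conv b a n.
Proof.
  revert a b; induction n as [|n IH]; intros a b; [simpl; ring|].
  rewrite conv_S_r; simpl; rewrite IH; ring.
Qed.

Lemma conv_assoc (a b c : fps) (n : nat) :
  conv a (conv b c) n = conv (conv a b) c n.
Proof.
  revert a; induction n as [|n IH]; intros a; simpl; [ring|].
  change (fshift (conv a b))
    with (fadd (fun k => a O * fshift b k) (conv (fshift a) b)).
  rewrite conv_add_l, conv_scale_l, IH; ring.
Qed.

Lemma fps_ring :
  ring_theory fzero (fcst 1) fadd fmul fsub fopp (@eq fps).
Proof.
  split; intros; apply functional_extensionality; intro n;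
    unfold fadd, fmul, fsub, fopp; try (unfold fzero; ring).
  - rewrite conv_fcst; ring.
  - apply conv_comm.
  - apply conv_assoc.
  - apply conv_add_l.
Qed.
Add Ring fps_ring : fps_ring.

Declare Scope fps_scope.
Delimit Scope fps_scope with fps.
Bind Scope fps_scope with fps.
Infix "+" := fadd : fps_scope.
Infix "*" := fmul : fps_scope.
Infix "-" := fsub : fps_scope.
Notation "- a" := (fopp a) : fps_scope.
Notation "1" := (fcst 1) : fps_scope.

Lemma fcst_mul (c : C) (Y : fps) (n : nat) : (fcst c * Y)%fps n = c * Y n.
Proof. apply conv_fcst. Qed.

(** Since [F a n] reads only coefficients before [n], [n] iterations of [F] freeze all coefficients
    below [n]; the diagonal of the iterates is the fixed point. *)
Lemma causal_fixpoint (F : fps -> nat -> C) :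
  (forall a b n, (forall k, (k < n)%nat -> a k = b k) -> F a n = F b n) ->
  exists a : fps, forall n, a n = F a n.
Proof.
  intros HF.
  pose (A := fix A (n : nat) : fps :=
    match n with O => fzero | S n' => F (A n') end).
  assert (St : forall n k p, (k < n)%nat -> (n <= p)%nat -> A p k = A n k).
  { induction n as [|n IH]; intros k p Hk Hp; [lia|].
    destruct p as [|p]; [lia|]; simpl.
    apply HF; intros l Hl; apply IH; lia. }
  exists (fun n => A (S n) n); intro n; simpl.
  apply HF; intros k Hk; apply (St (S k)); lia.
Qed.

Lemma fps_inverse (a : fps) : a O <> 0 -> exists b : fps, (a * b)%fps = 1%fps.
Proof.
  intros Ha.
  destruct (causal_fixpoint (fun b n => match n with
    | O => / a O
    | S n' => - conv (fshift a) b n' / a O end)) as [b Hb].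
  { intros b b' [|n] H; [reflexivity|].
    rewrite (conv_ext (fshift a) (fshift a) b b'); auto; intros; apply H; lia. }
  exists b; apply functional_extensionality; intros [|n]; unfold fmul; simpl;
    rewrite Hb; field; exact Ha.
Qed.

Lemma fps_sqrt (a : fps) (k : C) :
  k <> 0 -> a O = k * k -> exists b : fps, b O = k /\ (b * b)%fps = a.
Proof.
  intros Hk Ha.
  (* The unknown [c] is the tail of the root: b = k + T c with T the time shift. Comparing
     coefficients in b^2 = a gives 2 k c_0 = a_1 and 2 k c_(n+1) + (c^2)_n = a_(n+2). *)
  destruct (causal_fixpoint (fun c n => match n with
    | O => a 1%nat / (2 * k)
    | S n' => (a (S n) - conv c c n') / (2 * k) end)) as [c Hc].
  { intros b b' [|n] H; [reflexivity|].
    rewrite (conv_ext b b' b b'); auto; intros; apply H; lia. }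
  exists (fun n => match n with O => k | S n' => c n' end); split; [reflexivity|].
  set (b := fun n => match n with O => k | S n' => c n' end).
  apply functional_extensionality; intros [|[|n]]; unfold fmul.
  - simpl; auto.
  - simpl; unfold fshift; simpl; rewrite Hc; field; exact Hk.
  - rewrite conv_S_r.
    change (conv b (fshift b) (S n)) with (k * c (S n) + conv c c n).
    change (b (S (S n)) * b O) with (c (S n) * k).
    rewrite (Hc (S n)); field; exact Hk.
Qed.

(** * Symbol of the Crank-Nicolson time stepping *)

Lemma RtoC_neq_0 (x : R) : x <> 0%R -> RtoC x <> 0.
Proof. intros H E; apply H; injection E; auto. Qed.

Lemma diffusion_neq_0 (hbar B : R) :
  (0 < hbar)%R -> (0 < B)%R -> RtoC (hbar ^ 2 / 2) * B <> 0.
Proof.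
  intros Hh HB.
  rewrite <- RtoC_mult; apply RtoC_neq_0, Rgt_not_eq, Rmult_lt_0_compat; [|exact HB].
  assert (0 < hbar ^ 2)%R by (apply pow_lt; exact Hh); lra.
Qed.

(** Off the real axis |l| + Re l > 0, so the half-angle formula Re k = sqrt ((|l| + Re l) / 2) gives
    a strictly positive real part. *)
Lemma Csqrt_nonreal (l : C) :
  Im l <> 0%R -> exists k : C, (0 < Re k)%R /\ k * k = l.
Proof.
  destruct l as [p q]; simpl; intros Hq.
  set (n := sqrt (p * p + q * q)).
  assert (Hpq : (0 < q * q)%R) by nra.
  assert (Hn : (n * n = p * p + q * q)%R) by (apply sqrt_sqrt; nra).
  assert (Hn0 : (0 <= n)%R) by apply sqrt_pos.
  assert (Hnp : (0 < (n + p) / 2)%R) by nra.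
  set (al := sqrt ((n + p) / 2)).
  assert (Ha : (0 < al)%R) by (apply sqrt_lt_R0; exact Hnp).
  assert (Haa : (al * al = (n + p) / 2)%R) by (apply sqrt_sqrt; lra).
  exists (al, q / (2 * al))%R; split; [exact Ha|].
  unfold Cmult; simpl; f_equal; [|field; lra].
  replace (q / (2 * al) * (q / (2 * al)))%R with (q * q / (4 * (al * al)))%R
    by (field; lra).
  rewrite Haa.
  replace (q * q)%R with ((n - p) * (n + p))%R by lra.
  field; lra.
Qed.

Definition sbar_fps : fps := fun n => match n with O | 1%nat => / 2 | _ => 0 end.

Lemma sbar_fps_mul (Y : nat -> C) (m : nat) :
  Y O = 0 -> (1 <= m)%nat -> sbar_t Y m = (sbar_fps * Y)%fps m.
Proof.
  intros HY Hm; destruct m as [|m]; [lia|].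
  unfold sbar_t, fmul; simpl; rewrite Nat.sub_0_r.
  rewrite (conv_ext _ (fcst (/ 2)) Y Y), conv_fcst by (intros [|k] _; reflexivity).
  unfold Cdiv; ring.
Qed.

(* [mu] is the square root with positive real part of the symbol of the
   operator sending the generating function of [Psi] to that of [D^2 Psi]. *)
Definition is_symbol (hbar rho B V tau : R) (mu : fps) : Prop :=
  (0 < Re (mu O))%R /\ Im (mu O * mu O) <> 0%R /\
  forall (Y : nat -> C) (m : nat), Y O = 0 -> (1 <= m)%nat ->
    (hbar ^ 2 / 2)%R * B * (sbar_fps * (mu * mu) * Y)%fps m
    = V * sbar_t Y m - Ci * hbar * rho * dbar_t tau Y m.

Lemma symbol_exists (hbar rho B V tau : R) :
  (0 < tau)%R -> (0 < hbar)%R -> (0 < rho)%R -> (0 < B)%R ->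
  exists mu, is_symbol hbar rho B V tau mu.
Proof.
  intros Ht Hh Hr HB.
  set (a := (hbar ^ 2 / 2 * B)%R).
  assert (Ha : (0 < a)%R) by (unfold a; assert (0 < hbar ^ 2)%R by (apply pow_lt; lra); nra).
  assert (Ha' : RtoC a <> 0) by (apply RtoC_neq_0; lra).
  (* The coefficients of V (1 + T) / 2 - i hbar rho (1 - T) / tau, with T the time shift. *)
  set (d := fun n => match n with
    | O => V / 2 - Ci * hbar * rho / tau
    | 1%nat => V / 2 + Ci * hbar * rho / tau
    | _ => 0 end).
  (* The time average has constant coefficient 1/2, hence is invertible, and mu^2 can be solved for
     as a power series. *)
  destruct (fps_inverse sbar_fps) as [t Hst].
  { simpl; intro H; assert (E : / 2 * 2 = 0) by (rewrite H; ring).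
    rewrite Cinv_l in E; [|intro E2; injection E2; lra].
    injection E; lra. }
  assert (Ht0 : t O = 2).
  { assert (E : (sbar_fps * t)%fps O = 1) by (rewrite Hst; reflexivity).
    unfold fmul in E; simpl in E.
    transitivity (2 * (/ 2 * t O)); [field|rewrite E; ring]. }
  set (Lam := (fcst (/ a) * t * d)%fps).
  assert (HL0 : Lam O = ((V / a)%R, (- (2 * hbar * rho / tau / a))%R)).
  { unfold Lam, fmul; simpl; rewrite Ht0.
    unfold Ci, Cdiv; rewrite <- !RtoC_inv by lra.
    apply injective_projections; simpl; field; lra. }
  assert (HLi : Im (Lam O) <> 0%R).
  { rewrite HL0; simpl; apply Rlt_not_eq.
    assert (0 < 2 * hbar * rho / tau / a)%R; [|lra].
    repeat (apply Rdiv_lt_0_compat || apply Rmult_lt_0_compat); lra. }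
  destruct (Csqrt_nonreal _ HLi) as [k [Hk Hkk]].
  destruct (fps_sqrt Lam k) as [mu [Hmu0 Hmu]].
  { intro E; rewrite E in Hk; simpl in Hk; lra. }
  { auto. }
  exists mu; split; [rewrite Hmu0; exact Hk|split; [rewrite Hmu0, Hkk; exact HLi|]].
  intros Y m HY Hm.
  rewrite Hmu.
  replace (sbar_fps * Lam * Y)%fps with (fcst (/ a) * (d * Y))%fps.
  2:{ transitivity (fcst (/ a) * (sbar_fps * t * d * Y))%fps;
        [rewrite Hst|unfold Lam]; ring. }
  rewrite fcst_mul.
  rewrite <- RtoC_mult; fold a.
  destruct m as [|m]; [lia|].
  unfold fmul; simpl.
  rewrite (conv_ext _ (fcst (d 1%nat)) Y Y), conv_fcst by (intros [|j] _; reflexivity).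
  unfold sbar_t, dbar_t, d; simpl; rewrite Nat.sub_0_r.
  field; split; auto; intro E; injection E; lra.
Qed.

(** * Derivatives on a half-line *)

Section ComplexLimits.
Context {T : Type} {F : (T -> Prop) -> Prop} {FF : Filter F}.

Lemma filterlim_Cplus (f g : T -> C) (l m : C) :
  filterlim f F (locally l) -> filterlim g F (locally m) ->
  filterlim (fun t => f t + g t) F (locally (l + m)).
Proof.
  intros Hf Hg.
  exact (filterlim_comp_2 _ _ _ Hf Hg (filterlim_plus (V := C_R_NormedModule) l m)).
Qed.

Lemma filterlim_Cmult (f g : T -> C) (l m : C) :
  filterlim f F (locally l) -> filterlim g F (locally m) ->
  filterlim (fun t => f t * g t) F (locally (l * m)).
Proof.
  (* Neighbourhoods in [C] come from the product structure, while [filterlim_mult] uses those of the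
     absolute value; [locally_C] identifies them. *)
  assert (E : forall (u : T -> C) (a : C), filterlim u F (locally a) <->
    filterlim u F (locally (T := AbsRing_UniformSpace C_AbsRing) a)).
  { intros u a; split; intros H P HP; apply H; apply locally_C; exact HP. }
  rewrite !E; intros Hf Hg.
  exact (filterlim_comp_2 _ _ _ Hf Hg (filterlim_mult (K := C_AbsRing) l m)).
Qed.

Lemma filterlim_C_pair (f : T -> C) (l : C) :
  filterlim (fun t => Re (f t)) F (locally (Re l)) ->
  filterlim (fun t => Im (f t)) F (locally (Im l)) ->
  filterlim f F (locally l).
Proof.
  intros HR HI.
  apply filterlim_locally; intro eps.
  generalize (filter_and _ _ (proj1 (filterlim_locally _ _) HR eps)
    (proj1 (filterlim_locally _ _) HI eps)).
  apply filter_imp; intros t [H1 H2]; split; assumption.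
Qed.

Lemma filterlim_C_bound (f : T -> C) (g : T -> R) :
  F (fun t => (Cmod (f t) <= g t)%R) -> filterlim g F (locally 0%R) ->
  filterlim f F (locally (0 : C)).
Proof.
  intros Hfg Hg.
  apply filterlim_locally; intro eps.
  generalize (filter_and _ _ Hfg (proj1 (filterlim_locally _ _) Hg eps)).
  apply filter_imp; intros t [H1 H2].
  assert (H3 : (Cmod (f t) < eps)%R).
  { apply Rle_lt_trans with (1 := H1).
    apply Rabs_def2 in H2. unfold minus, plus, opp in H2; simpl in H2; lra. }
  generalize (Rmax_Cmod (f t)); intro H4.
  assert (H5 := Rmax_l (Rabs (fst (f t))) (Rabs (snd (f t)))).
  assert (H6 := Rmax_r (Rabs (fst (f t))) (Rabs (snd (f t)))).
  split; change (Rabs (minus (fst (f t)) 0) < eps)%R || change (Rabs (minus (snd (f t)) 0) < eps)%R;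
  unfold minus, plus, opp; simpl; rewrite Ropp_0, Rplus_0_r; lra.
Qed.

Lemma filterlim_Cmod (f : T -> C) :
  filterlim f F (locally (0 : C)) -> filterlim (fun t => Cmod (f t)) F (locally 0%R).
Proof.
  intros H.
  assert (E : forall z : C, norm (V := C_R_NormedModule) z = Cmod z).
  { intro z; unfold Cmod; rewrite <- (pow2_abs (fst z)), <- (pow2_abs (snd z)).
    reflexivity. }
  rewrite <- Cmod_0, <- E.
  apply filterlim_ext with (fun t => norm (V := C_R_NormedModule) (f t)).
  { intro t; apply E. }
  apply (filterlim_comp _ _ _ f _ F _ _ H).
  exact (filterlim_norm (V := C_R_NormedModule) (0 : C)).
Qed.
End ComplexLimits.

Section Derivatives.
Context (X : R).

Let Fr (x : R) := within (fun y : R => (X <= y)%R) (locally' x).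

(** Points slightly to the right of [x] always survive the restriction to the half-line; this is
    what makes derivatives unique even at [X]. *)
Lemma right_punctured_proper (x : R) : (X <= x)%R -> ProperFilter' (Fr x).
Proof.
  intros Hx; split; [|unfold Fr; apply _].
  intros [eps H].
  specialize (H (x + eps / 2)%R); assert (Hp := cond_pos eps).
  apply H; [|lra|lra].
  change (Rabs (minus (x + eps / 2) x) < eps)%R.
  unfold minus, plus, opp; simpl.
  replace (x + eps / 2 + - x)%R with (eps / 2)%R by ring.
  rewrite Rabs_pos_eq; lra.
Qed.

Lemma is_derive_from_unique (f : R -> C) (x : R) (l m : C) :
  (X <= x)%R -> is_derive_from X f x l -> is_derive_from X f x m -> l = m.
Proof.
  intros Hx Hl Hm.
  exact (filterlim_locally_unique (V := C_R_NormedModule)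
    (FF := right_punctured_proper x Hx) _ l m Hl Hm).
Qed.

Lemma is_derive_from_ext (f g : R -> C) (x : R) (l : C) :
  (X <= x)%R -> (forall y, (X <= y)%R -> f y = g y) ->
  is_derive_from X f x l -> is_derive_from X g x l.
Proof.
  intros Hx E; apply filterlim_ext_loc.
  exists posreal_one; intros y _ _ Hy; rewrite !E; auto.
Qed.

Lemma is_derive_from_const (c : C) (x : R) : is_derive_from X (fun _ => c) x 0.
Proof.
  apply filterlim_ext with (fun _ : R => RtoC 0).
  - intro y; unfold Cdiv; ring.
  - apply filterlim_const.
Qed.

Lemma is_derive_from_plus (f g : R -> C) (x : R) (l m : C) :
  is_derive_from X f x l -> is_derive_from X g x m ->
  is_derive_from X (fun y => f y + g y) x (l + m).
Proof.
  intros Hf Hg.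
  eapply filterlim_ext; [|exact (filterlim_Cplus _ _ _ _ Hf Hg)].
  intro y; unfold Cdiv; simpl; ring.
Qed.

Lemma is_derive_from_continuous (f : R -> C) (x : R) (l : C) :
  is_derive_from X f x l -> filterlim f (Fr x) (locally (f x)).
Proof.
  intros Hf.
  replace (locally (f x)) with (locally (f x + l * (x - x)%R : C)).
  2:{ f_equal; replace (x - x)%R with 0%R by ring; ring. }
  apply filterlim_ext_loc with (fun y => f x + (f y - f x) / (y - x)%R * (y - x)%R).
  - exists posreal_one; intros y _ Hy _; field.
    intro E; injection E; intro E'; apply Hy; lra.
  - apply filterlim_Cplus; [apply filterlim_const|].
    apply filterlim_Cmult; [exact Hf|].
    apply filterlim_C_pair; simpl; [|apply filterlim_const].
    apply (filterlim_filter_le_1 (F := locally x)).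
    { intros P HP.
      apply (filter_imp (F := locally x) P); [intros y Hy _ _; exact Hy|exact HP]. }
    apply (continuous_minus (fun y : R => y) (fun _ : R => x) x);
      [apply continuous_id|apply continuous_const].
Qed.

Lemma is_derive_from_mult (f g : R -> C) (x : R) (l m : C) :
  is_derive_from X f x l -> is_derive_from X g x m ->
  is_derive_from X (fun y => f y * g y) x (l * g x + f x * m).
Proof.
  intros Hf Hg.
  apply filterlim_ext with
    (fun y => (f y - f x) / (y - x)%R * g x + f y * ((g y - g x) / (y - x)%R)).
  - intro y; unfold Cdiv; ring.
  - apply filterlim_Cplus; apply filterlim_Cmult; auto.
    + apply filterlim_const.
    + exact (is_derive_from_continuous _ _ _ Hf).
Qed.

Lemma is_derive_from_scale (c : C) (f : R -> C) (x : R) (l : C) :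
  is_derive_from X f x l -> is_derive_from X (fun y => c * f y) x (c * l).
Proof.
  intros Hf; replace (c * l) with (0 * f x + c * l) by ring.
  apply (is_derive_from_mult (fun _ => c)); auto using is_derive_from_const.
Qed.

Lemma is_derive_from_pair (f g : R -> R) (x : R) (l m : R) :
  is_derive f x l -> is_derive g x m ->
  is_derive_from X (fun y => (f y, g y)) x (l, m).
Proof.
  assert (D : forall (u : R -> R) a, is_derive u x a ->
    filterlim (fun y => ((u y - u x) / (y - x))%R) (Fr x) (locally a)).
  { intros u a Hu.
    apply is_derive_Reals in Hu.
    apply filterlim_locally; intro eps.
    destruct (Hu eps (cond_pos eps)) as [dl Hd].
    exists dl; intros y Hy Hyx _.
    specialize (Hd (y - x)%R).
    rewrite Rplus_minus in Hd.
    apply Hd; [lra | exact Hy]. }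
  assert (Q : forall y a b : R, (y - x <> 0)%R ->
    (a, b) / (y - x)%R = ((a / (y - x))%R, (b / (y - x))%R)).
  { intros y a b Hy; unfold Cdiv; rewrite <- RtoC_inv by exact Hy.
    apply injective_projections; simpl; field; exact Hy. }
  intros Hf Hg; apply filterlim_C_pair.
  - eapply filterlim_ext_loc; [|exact (D _ _ Hf)].
    exists posreal_one; intros y _ Hy _.
    change ((f y, g y) - (f x, g x)) with ((f y - f x)%R, (g y - g x)%R).
    rewrite Q by lra; reflexivity.
  - eapply filterlim_ext_loc; [|exact (D _ _ Hg)].
    exists posreal_one; intros y _ Hy _.
    change ((f y, g y) - (f x, g x)) with ((f y - f x)%R, (g y - g x)%R).
    rewrite Q by lra; reflexivity.
Qed.
End Derivatives.

(** * Linear equations on a half-line *)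

Section Ode.
Context (X : R).

Lemma Re_derive_zero (f : R -> C) :
  (forall x, (X <= x)%R -> is_derive_from X f x 0) ->
  forall x, (X <= x)%R -> Re (f x) = Re (f X).
Proof.
  intros Hf x Hx.
  (* Freezing [f] to the left of [X] gives a function on the whole line that is continuous at [X],
     as the mean value theorem requires. *)
  set (g := fun y => Re (f (Rmax X y))).
  assert (G : forall y, (X <= y)%R -> g y = Re (f y)).
  { intros y Hy; unfold g; rewrite Rmax_right; auto. }
  rewrite <- !G by lra.
  destruct (MVT_gen g X x (fun _ => 0%R)) as [c [_ Hc]].
  - intros y; rewrite Rmin_left, Rmax_right by lra; intros Hy.
    apply is_derive_Reals; intros eps Heps.
    destruct (proj1 (filterlim_locally _ _) (Hf y (Rlt_le _ _ (proj1 Hy)))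
      (mkposreal _ Heps)) as [d Hd].
    (* The radius y - X keeps [y + t] inside the half-line, where [g] is the real part of [f]. *)
    assert (Hd' : (0 < Rmin d (y - X))%R)
      by (apply Rmin_glb_lt; [apply cond_pos|lra]).
    exists (mkposreal _ Hd'); intros t Ht Htd; simpl in Htd.
    assert (Htd1 := Rlt_le_trans _ _ _ Htd (Rmin_l _ _)).
    assert (Htd2 := Rlt_le_trans _ _ _ Htd (Rmin_r _ _)).
    apply Rabs_def2 in Htd2.
    rewrite !G by lra.
    destruct (Hd (y + t)%R) as [H _].
    + change (Rabs (y + t - y) < d)%R.
      replace (y + t - y)%R with t by ring; exact Htd1.
    + lra.
    + lra.
    + revert H; unfold ball; simpl; unfold AbsRing_ball; simpl.
      replace (y + t - y)%R with t by ring.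
      intro H; eapply Rle_lt_trans; [|exact H]; apply Req_le.
      unfold abs, minus, plus, opp; simpl; f_equal.
      unfold Re; field; exact Ht.
  - intros y; rewrite Rmin_left, Rmax_right by lra; intros Hy.
    intros eps Heps.
    destruct (proj1 (filterlim_locally _ _)
      (is_derive_from_continuous X f y _ (Hf y (proj1 Hy)))
      (mkposreal _ Heps)) as [d Hd].
    exists d; split; [apply cond_pos|]; intros t [_ Ht].
    simpl in Ht |- *; unfold R_dist in *.
    rewrite (G y) by lra; unfold g.
    (* The limit giving continuity is punctured at [y], so this point is treated apart. *)
    destruct (Req_dec (Rmax X t) y) as [E|E].
    { rewrite E, Rminus_diag, Rabs_R0; exact Heps. }
    destruct (Hd (Rmax X t)) as [H _]; auto using Rmax_l.
    change (Rabs (Rmax X t - y) < d)%R.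
    apply Rabs_def2 in Ht; apply Rabs_def1; unfold Rmax;
      destruct (Rle_dec X t); lra.
  - lra.
Qed.

Lemma derive_zero_constant (f : R -> C) :
  (forall x, (X <= x)%R -> is_derive_from X f x 0) ->
  forall x, (X <= x)%R -> f x = f X.
Proof.
  intros Hf x Hx; apply injective_projections.
  - exact (Re_derive_zero f Hf x Hx).
  (* Im f is the real part of - i f. *)
  - assert (E := Re_derive_zero (fun y => - Ci * f y)).
    simpl in E; specialize (fun H => E H x Hx).
    assert (P : forall y, (X <= y)%R -> is_derive_from X (fun y => - Ci * f y) y 0).
    { intros y Hy; replace (RtoC 0) with (- Ci * 0) by ring.
      apply is_derive_from_scale; auto. }
    specialize (E P); unfold Im; lra.
Qed.

Definition cexp (k : C) (x : R) : C :=
  ((exp (Re k * x) * cos (Im k * x))%R, (exp (Re k * x) * sin (Im k * x))%R).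

Lemma cexp_0 (k : C) : cexp k 0 = 1.
Proof. unfold cexp; rewrite !Rmult_0_r, exp_0, cos_0, sin_0, !Rmult_1_l; reflexivity. Qed.

Lemma Cmod_cexp (k : C) (x : R) : Cmod (cexp k x) = exp (Re k * x).
Proof.
  unfold Cmod, cexp; simpl.
  transitivity (sqrt (Rsqr (exp (Re k * x))));
    [|apply sqrt_Rsqr, Rlt_le, exp_pos].
  f_equal; generalize (sin2_cos2 (Im k * x)); unfold Rsqr; intro H.
  transitivity (exp (Re k * x) * exp (Re k * x) * (sin (Im k * x) * sin (Im k * x)
    + cos (Im k * x) * cos (Im k * x)))%R; [ring|rewrite H; ring].
Qed.

Lemma cexp_inv (k : C) (x : R) : cexp k x * cexp (- k) x = 1.
Proof.
  unfold cexp.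
  replace (Re (- k) * x)%R with (- (Re k * x))%R by (unfold Re; simpl; ring).
  replace (Im (- k) * x)%R with (- (Im k * x))%R by (unfold Im; simpl; ring).
  rewrite cos_neg, sin_neg.
  assert (H := sin2_cos2 (Im k * x)); unfold Rsqr in H.
  assert (H' := exp_plus (Re k * x) (- (Re k * x))).
  rewrite Rplus_opp_r, exp_0 in H'.
  apply injective_projections; simpl; [|ring].
  transitivity ((exp (Re k * x) * exp (- (Re k * x))) * (sin (Im k * x) * sin (Im k * x)
    + cos (Im k * x) * cos (Im k * x)))%R; [ring|rewrite H, <- H'; ring].
Qed.

Lemma is_derive_from_cexp (k : C) (x : R) :
  is_derive_from X (fun y => cexp k (y - X)) x (k * cexp k (x - X)).
Proof.
  replace (k * cexp k (x - X)) with
   ((exp (Re k * (x - X)) * (Re k * cos (Im k * (x - X)) - Im k * sin (Im k * (x - X))))%R,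
    (exp (Re k * (x - X)) * (Re k * sin (Im k * (x - X)) + Im k * cos (Im k * (x - X))))%R).
  2:{ apply injective_projections; unfold cexp, Re, Im; simpl; ring. }
  apply is_derive_from_pair; auto_derive; auto; unfold Rminus; ring.
Qed.

(** Integrating factor: f e^(-k (x - X)) has zero derivative. *)
Lemma ode_first_order (k : C) (f : R -> C) :
  (forall x, (X <= x)%R -> is_derive_from X f x (k * f x)) ->
  forall x, (X <= x)%R -> f x = f X * cexp k (x - X).
Proof.
  intros Hf x Hx.
  assert (E : f x * cexp (- k) (x - X) = f X * cexp (- k) (X - X)).
  { apply (derive_zero_constant (fun y => f y * cexp (- k) (y - X))); [|exact Hx].
    intros y Hy.
    replace (RtoC 0) with
      (k * f y * cexp (- k) (y - X) + f y * (- k * cexp (- k) (y - X))) by ring.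
    apply (is_derive_from_mult X f (fun y => cexp (- k) (y - X)));
      [auto|apply is_derive_from_cexp]. }
  rewrite Rminus_diag, cexp_0 in E.
  transitivity (f x * (cexp k (x - X) * cexp (- k) (x - X)));
    [rewrite cexp_inv; ring|].
  transitivity (f x * cexp (- k) (x - X) * cexp k (x - X)); [ring|rewrite E; ring].
Qed.

Lemma exp_decay (c : R) : (0 < c)%R ->
  filterlim (fun x => exp (- c * (x - X))) (Rbar_locally p_infty) (locally 0%R).
Proof.
  intros Hc.
  apply (filterlim_comp _ _ _ (fun x => (- c * (x - X))%R) exp _ (Rbar_locally m_infty)).
  - intros P [M HM]; exists (X - M / c)%R; intros y Hy; apply HM.
    apply Ropp_lt_cancel; replace (- (- c * (y - X)))%R with (c * (y - X))%R by ring.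
    replace (- M)%R with (c * (- M / c))%R by (field; lra).
    apply Rmult_lt_compat_l; lra.
  - exact is_lim_exp_m.
Qed.

(* The factorization D^2 - k^2 = (D - k)(D + k) leaves
   W = a e^(k (x - X)) + b e^(-k (x - X)). *)
Lemma ode_second_order_decaying (k : C) (W DW D2W : R -> C) :
  (0 < Re k)%R ->
  (forall x, (X <= x)%R -> is_derive_from X W x (DW x)) ->
  (forall x, (X <= x)%R -> is_derive_from X DW x (D2W x)) ->
  (forall x, (X <= x)%R -> D2W x = k * k * W x) ->
  W X = 0 -> filterlim W (Rbar_locally p_infty) (locally (0 : C)) ->
  forall x, (X <= x)%R -> W x = 0.
Proof.
  intros Hk H1 H2 H3 H0 Hlim.
  assert (Hk0 : k <> 0) by (intro E; rewrite E in Hk; simpl in Hk; lra).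
  set (U := fun x => DW x + k * W x).
  assert (HU : forall x, (X <= x)%R -> U x = U X * cexp k (x - X)).
  { apply ode_first_order; intros x Hx.
    replace (k * U x) with (D2W x + k * DW x) by (rewrite H3 by exact Hx; unfold U; ring).
    apply is_derive_from_plus; [|apply is_derive_from_scale]; auto. }
  (* The amplitude of the growing mode, since U = DW + k W equals 2 k a e^(k (x - X)); the condition
     W(X) = 0 then forces b = - a. *)
  set (a := U X / (2 * k)).
  assert (HW : forall x, (X <= x)%R ->
    W x - a * cexp k (x - X) = - a * cexp (- k) (x - X)).
  { intros x Hx.
    set (G := fun x => W x + - a * cexp k (x - X)).
    transitivity (G x); [unfold G; ring|].
    replace (- a) with (G X)
      by (unfold G; rewrite H0, Rminus_diag, cexp_0; ring).
    apply ode_first_order; [|exact Hx]; intros y Hy.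
    replace (- k * G y) with (DW y + - a * (k * cexp k (y - X))).
    - apply is_derive_from_plus; [auto|].
      apply is_derive_from_scale, is_derive_from_cexp.
    - transitivity (U y - k * W y - k * (a * cexp k (y - X))); [unfold U; ring|].
      rewrite HU by exact Hy; unfold G, a; field; exact Hk0. }
  (* W + a e^(-k (x - X)) = a e^(k (x - X)) tends to zero, although its modulus is at least |a|. *)
  assert (Ha : a = 0).
  { assert (Hl : filterlim (fun x => Cmod (W x + a * cexp (- k) (x - X)))
      (Rbar_locally p_infty) (locally 0%R)).
    { apply filterlim_Cmod; replace (RtoC 0) with (0 + a * 0) by ring.
      apply filterlim_Cplus; [exact Hlim|].
      apply filterlim_Cmult; [apply filterlim_const|].
      apply filterlim_C_bound with (fun x => exp (- Re k * (x - X)));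
        [|apply exp_decay; exact Hk].
      apply filter_forall; intro x; rewrite Cmod_cexp; apply Rle_refl. }
    apply Cmod_eq_0, Rle_antisym; [|apply Cmod_ge_0].
    change (Rbar_le (Cmod a) 0).
    apply (filterlim_le (F := Rbar_locally p_infty) (fun _ => Cmod a)
      (fun x => Cmod (W x + a * cexp (- k) (x - X)))); [|apply filterlim_const|exact Hl].
    exists X; intros x Hx.
    replace (W x + a * cexp (- k) (x - X)) with (a * cexp k (x - X)).
    2:{ transitivity (W x - (W x - a * cexp k (x - X))); [ring|].
        rewrite HW by lra; ring. }
    rewrite Cmod_mult, Cmod_cexp.
    assert (H4 := exp_ineq1_le (Re k * (x - X))).
    assert (H5 : (0 <= Re k * (x - X))%R) by (apply Rmult_le_pos; lra).
    rewrite <- (Rmult_1_r (Cmod a)) at 1.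
    apply Rmult_le_compat_l; [apply Cmod_ge_0|lra]. }
  intros x Hx; generalize (HW x Hx); rewrite Ha; intro E.
  transitivity (W x - 0 * cexp k (x - X)); [ring|rewrite E; ring].
Qed.
End Ode.

(** * The semi-discrete problem *)

Lemma conv_scale_r (z : C) (a b : fps) (n : nat) :
  conv a (fun k => z * b k) n = z * conv a b n.
Proof. rewrite conv_comm, conv_scale_l, conv_comm; reflexivity. Qed.

Fixpoint fpow_mul (N : fps) (k : nat) (Phi : fps) : fps :=
  match k with O => Phi | S k' => (N * fpow_mul N k' Phi)%fps end.

Lemma fpow_mul_vanish (N Phi : fps) (k m : nat) :
  N O = 0 -> (m < k)%nat -> fpow_mul N k Phi m = 0.
Proof.
  intros HN; revert m; induction k as [|k IH]; intros m Hm; [lia|].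
  simpl; unfold fmul; destruct m as [|m]; simpl; rewrite HN; [ring|].
  rewrite conv_comm, conv_comm, conv_zero_r; [ring|intros; apply IH; lia].
Qed.

(** The Taylor polynomial of order [K] of exp (- t N) Phi. *)
Fixpoint exp_sum (N Phi : fps) (K : nat) (t : R) : fps :=
  match K with
  | O => Phi
  | S K' => (exp_sum N Phi K' t
             + fcst ((- t) ^ K / INR (fact K))%R * fpow_mul N K Phi)%fps
  end.

(** Each factor [N] raises the order by one, so terms beyond [m] do not reach coefficient [m]:
    there, truncation at [m] is exact. *)
Lemma exp_sum_stable (N Phi : fps) (K m : nat) (t : R) :
  N O = 0 -> (m <= K)%nat -> exp_sum N Phi K t m = exp_sum N Phi m t m.
Proof.
  intros HN H; induction H as [|K H IH]; [reflexivity|].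
  cbn [exp_sum]; unfold fadd; rewrite fcst_mul, IH.
  rewrite fpow_mul_vanish by (auto; lia); ring.
Qed.

Lemma exp_sum_0 (N Phi : fps) (K : nat) : exp_sum N Phi K 0 = Phi.
Proof.
  induction K as [|K IH]; [reflexivity|]; cbn [exp_sum]; rewrite IH.
  replace ((- 0) ^ S K / INR (fact (S K)))%R with 0%R
    by (simpl pow; unfold Rdiv; ring).
  apply functional_extensionality; intro n.
  unfold fadd; rewrite fcst_mul; ring.
Qed.

(** Half of the rate [e] absorbs one factor t <= (2 / e) exp (e t / 2); the other half is left to
    the induction. *)
Lemma pow_le_exp (j : nat) (e : R) : (0 < e)%R ->
  exists M, (0 <= M)%R /\ forall t, (0 <= t)%R -> (t ^ j <= M * exp (e * t))%R.
Proof.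
  revert e; induction j as [|j IH]; intros e He.
  - exists 1%R; split; [lra|]; intros t Ht; simpl.
    assert (H := exp_ineq1_le (e * t)); assert (0 <= e * t)%R by (apply Rmult_le_pos; lra); lra.
  - destruct (IH (e / 2)%R) as [M [HM H]]; [lra|].
    exists (2 / e * M)%R; split.
    { apply Rmult_le_pos; [apply Rlt_le, Rdiv_lt_0_compat|]; lra. }
    intros t Ht; simpl.
    replace (e * t)%R with (e / 2 * t + e / 2 * t)%R by field; rewrite exp_plus.
    replace (2 / e * M * (exp (e / 2 * t) * exp (e / 2 * t)))%R
      with ((2 / e * exp (e / 2 * t)) * (M * exp (e / 2 * t)))%R by ring.
    apply Rmult_le_compat; auto using pow_le.
    assert (H' := exp_ineq1_le (e / 2 * t)).
    replace t with (2 / e * (e / 2 * t))%R at 1 by (field; lra).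
    apply Rmult_le_compat_l; [apply Rlt_le, Rdiv_lt_0_compat; lra|lra].
Qed.

Lemma is_derive_from_conv (X : R) (c : fps) (F : nat -> R -> C) (D : fps) (x : R) (m : nat) :
  (forall i, (i <= m)%nat -> is_derive_from X (F i) x (D i)) ->
  is_derive_from X (fun y => conv c (fun i => F i y) m) x (conv c D m).
Proof.
  revert c; induction m as [|m IH]; intros c H; simpl.
  - apply is_derive_from_scale, H; lia.
  - apply is_derive_from_plus; [apply is_derive_from_scale, H; lia|].
    apply IH; intros; apply H; lia.
Qed.

Lemma exp_sum_S (N Phi : fps) (K m : nat) (t : R) :
  exp_sum N Phi (S K) t m = exp_sum N Phi K t m
    + fpow_mul N (S K) Phi m * ((- t) ^ S K / INR (fact (S K)))%R.
Proof. cbn [exp_sum]; unfold fadd; rewrite fcst_mul; ring. Qed.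

(** Differentiating a Taylor polynomial of the exponential lowers its order by one; [exp_sum_stable]
    later makes this loss harmless. *)
Lemma is_derive_from_exp_sum (X : R) (N Phi : fps) (K m : nat) (x : R) :
  (X <= x)%R ->
  is_derive_from X (fun y => exp_sum N Phi (S K) (y - X) m) x
    (fopp (N * exp_sum N Phi K (x - X))%fps m).
Proof.
  intros Hx.
  assert (P : forall j, is_derive_from X
    (fun y => RtoC ((- (y - X)) ^ S j / INR (fact (S j)))) x
    (- ((- (x - X)) ^ j / INR (fact j)))%R).
  { intro j; apply is_derive_from_pair; [|apply (is_derive_const 0%R x)].
    rewrite fact_simpl, mult_INR.
    generalize (INR (fact j)) (INR_fact_neq_0 j); intros c Hc.
    assert (Hj : INR (S j) <> 0%R) by (apply not_0_INR; lia).
    auto_derive; [auto|]; change (Init.Nat.pred (S j)) with j.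
    change (match j with O => 1%R | S _ => (INR j + 1)%R end) with (INR (S j)).
    unfold Rminus; field; split; auto. }
  induction K as [|K IH].
  - apply (is_derive_from_ext X (fun y => Phi m + fpow_mul N 1 Phi m *
      RtoC ((- (y - X)) ^ 1 / INR (fact 1)))); auto.
    { intros y _; rewrite exp_sum_S; reflexivity. }
    replace (fopp _ m) with
      (0 + fpow_mul N 1 Phi m * RtoC (- ((- (x - X)) ^ 0 / INR (fact 0)))).
    2:{ simpl; unfold fopp; rewrite RtoC_opp, Rdiv_1_r; ring. }
    apply is_derive_from_plus; [apply is_derive_from_const|].
    apply is_derive_from_scale, P.
  - apply (is_derive_from_ext X (fun y => exp_sum N Phi (S K) (y - X) m
      + fpow_mul N (S (S K)) Phi m *
        RtoC ((- (y - X)) ^ S (S K) / INR (fact (S (S K)))))); auto.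
    { intros y _; symmetry; apply exp_sum_S. }
    replace (fopp (N * exp_sum N Phi (S K) (x - X))%fps m) with
      (fopp (N * exp_sum N Phi K (x - X))%fps m + fpow_mul N (S (S K)) Phi m *
      RtoC (- ((- (x - X)) ^ S K / INR (fact (S K))))).
    { apply is_derive_from_plus; [exact IH|].
      apply is_derive_from_scale, P. }
    cbn [exp_sum].
    set (c := ((- (x - X)) ^ S K / INR (fact (S K)))%R).
    replace (N * (exp_sum N Phi K (x - X) + fcst c * fpow_mul N (S K) Phi))%fps
      with (N * exp_sum N Phi K (x - X) + fcst c * fpow_mul N (S (S K)) Phi)%fps
      by (cbn [fpow_mul]; ring).
    unfold fopp, fadd; rewrite fcst_mul, RtoC_opp; ring.
Qed.

Lemma cexp_exp_sum_decay (X : R) (k : C) (N Phi : fps) (K m : nat) :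
  (0 < Re k)%R ->
  filterlim (fun x => cexp (- k) (x - X) * exp_sum N Phi K (x - X) m)
    (Rbar_locally p_infty) (locally (0 : C)).
Proof.
  intros Hk.
  assert (P : forall j (c : R), filterlim
     (fun x => cexp (- k) (x - X) * RtoC ((- (x - X)) ^ j / c))
     (Rbar_locally p_infty) (locally (0 : C))).
  (* Half of the decay rate is spent on the power of x - X, the other half remains for the decay. *)
  { intros j c; destruct (pow_le_exp j (Re k / 2)) as [M [HM H]]; [lra|].
    apply filterlim_C_bound with
      (fun x => (M * Rabs (/ c) * exp (- (Re k / 2) * (x - X)))%R).
    - exists X; intros x Hx; rewrite Cmod_mult, Cmod_cexp, Cmod_R.
      unfold Rdiv at 1; rewrite Rabs_mult, <- RPow_abs, Rabs_Ropp, (Rabs_pos_eq (x - X)) by lra.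
      replace (Re (- k)) with (- Re k)%R by (unfold Re; reflexivity).
      replace (- (Re k / 2) * (x - X))%R
        with (- Re k * (x - X) + Re k / 2 * (x - X))%R by field.
      rewrite exp_plus.
      replace (M * Rabs (/ c) * (exp (- Re k * (x - X)) * exp (Re k / 2 * (x - X))))%R
        with (exp (- Re k * (x - X)) * ((M * exp (Re k / 2 * (x - X))) * Rabs (/ c)))%R
        by ring.
      apply Rmult_le_compat_l; [apply Rlt_le, exp_pos|].
      apply Rmult_le_compat_r; [apply Rabs_pos|apply H; lra].
    - replace 0%R with (M * Rabs (/ c) * 0)%R by ring.
      apply (filterlim_comp_2 (G := locally (M * Rabs (/ c))%R) (H := locally 0%R)
         (fun _ => (M * Rabs (/ c))%R) _ Rmult).
      + apply filterlim_const.
      + apply exp_decay; lra.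
      + exact (filterlim_mult (K := R_AbsRing) _ _). }
  induction K as [|K IH].
  - apply filterlim_ext with (fun x => cexp (- k) (x - X) * RtoC ((- (x - X)) ^ 0 / 1) * Phi m).
    { intro x; simpl; rewrite Rdiv_1_r; ring. }
    replace (RtoC 0) with (0 * Phi m) by ring.
    apply filterlim_Cmult; [apply P|apply filterlim_const].
  - apply filterlim_ext with (fun x => cexp (- k) (x - X) * exp_sum N Phi K (x - X) m
      + cexp (- k) (x - X) * RtoC ((- (x - X)) ^ S K / INR (fact (S K)))
        * fpow_mul N (S K) Phi m).
    { intro x; rewrite exp_sum_S; ring. }
    replace (RtoC 0) with (0 + 0 * fpow_mul N (S K) Phi m) by ring.
    apply filterlim_Cplus; [exact IH|].
    apply filterlim_Cmult; [apply P|apply filterlim_const].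
Qed.

Section SemiDiscrete.
Context (hbar rho B V tau X : R) (mu : fps).
Hypothesis mu_symbol : is_symbol hbar rho B V tau mu.

Let N : fps := (mu - fcst (mu O))%fps.

Let N_0 : N O = 0.
Proof. unfold N, fsub; simpl; ring. Qed.

Definition transparent_op (Phi : nat -> C) (m : nat) : C :=
  fopp (sbar_fps * (mu * Phi))%fps m.

(* This is [exp (- mu (x - X)) Phi], expanded around the constant coefficient
   of [mu]; the expansion is finite in each coefficient. *)
Definition semi_wave (Phi : fps) (m : nat) (x : R) : C :=
  cexp (- mu O) (x - X) * exp_sum N Phi m (x - X) m.

Lemma semi_wave_derive (Phi : fps) (m : nat) (x : R) : (X <= x)%R ->
  is_derive_from X (semi_wave Phi m) x (fopp (mu * (fun i => semi_wave Phi i x))%fps m).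
Proof.
  intros Hx.
  set (Y := fun i => semi_wave Phi i x).
  (* Product rule with mu = mu_0 + N: the exponential contributes - mu_0, the Taylor polynomial - N.
     Order [S m] is used so that order [m] is left after differentiation. *)
  replace (fopp (mu * Y)%fps m)
    with (- mu O * cexp (- mu O) (x - X) * exp_sum N Phi (S m) (x - X) m
       + cexp (- mu O) (x - X) * fopp (N * exp_sum N Phi m (x - X))%fps m).
  - apply (is_derive_from_ext X (fun y => cexp (- mu O) (y - X) * exp_sum N Phi (S m) (y - X) m));
      [exact Hx| |].
    { intros y _; unfold semi_wave; f_equal; apply exp_sum_stable; auto. }
    apply (is_derive_from_mult X (fun y => cexp (- mu O) (y - X))
      (fun y => exp_sum N Phi (S m) (y - X) m)).
    + apply is_derive_from_cexp.
    + apply is_derive_from_exp_sum; exact Hx.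
  - replace (mu * Y)%fps with (fcst (mu O) * Y + N * Y)%fps by (unfold N; ring).
    unfold fopp, fadd, fmul; rewrite conv_fcst.
    rewrite (exp_sum_stable N Phi (S m) m) by auto.
    unfold Y at 1, semi_wave.
    (* Coefficient [i] of [Y] is truncated at its own order [i]; for i <= m the common order [m]
       gives the same value. *)
    rewrite (conv_ext N N Y (fun i => cexp (- mu O) (x - X) * exp_sum N Phi m (x - X) i)).
    + rewrite conv_scale_r; ring.
    + auto.
    + intros i Hi; unfold Y, semi_wave; f_equal; symmetry; apply exp_sum_stable; auto.
Qed.

Lemma semi_wave_solution (Phi : nat -> C) : Phi O = 0 ->
  is_SDTBC_solution hbar rho B V tau X Phi (semi_wave Phi).
Proof.
  intros HPhi.
  assert (H0 : forall x, semi_wave Phi O x = 0).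
  { intro x; unfold semi_wave; simpl; rewrite HPhi; ring. }
  repeat split.
  - intros m Hm.
    set (Y := fun x : R => (fun i => semi_wave Phi i x) : fps).
    assert (HY : forall x i, (X <= x)%R ->
      is_derive_from X (fun y => Y y i) x (fopp (mu * Y x)%fps i)).
    { intros x i Hx; apply semi_wave_derive, Hx. }
    assert (HD : forall x i, (X <= x)%R ->
      is_derive_from X (fun y => fopp (mu * Y y)%fps i) x (fopp (mu * fopp (mu * Y x))%fps i)).
    { intros x i Hx; unfold fopp at 1 2.
      replace (- (mu * fopp (mu * Y x))%fps i) with (- RtoC 1 * (mu * fopp (mu * Y x))%fps i) by ring.
      apply (is_derive_from_ext X (fun y => - RtoC 1 * (mu * Y y)%fps i)); [exact Hx|intros; ring|].
      apply is_derive_from_scale.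
      apply (is_derive_from_conv X mu (fun i y => Y y i)); auto. }
    exists (fun x => (sbar_fps * fopp (mu * Y x))%fps m),
      (fun x => (sbar_fps * fopp (mu * fopp (mu * Y x)))%fps m).
    intros x Hx; split; [|split].
    + apply (is_derive_from_ext X (fun y => (sbar_fps * Y y)%fps m)); [exact Hx| |].
      { intros y _; symmetry; apply sbar_fps_mul; auto. }
      apply (is_derive_from_conv X sbar_fps (fun i y => Y y i)); auto.
    + apply (is_derive_from_conv X sbar_fps (fun i y => fopp (mu * Y y)%fps i)); auto.
    + replace (sbar_fps * fopp (mu * fopp (mu * Y x)))%fps
        with (sbar_fps * (mu * mu) * Y x)%fps by ring.
      destruct mu_symbol as [_ [_ Hmu]].
      specialize (Hmu (Y x) m (H0 x) Hm).
      transitivity (- ((hbar ^ 2 / 2)%R * B * (sbar_fps * (mu * mu) * Y x)%fps m)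
        + V * sbar_t (Y x) m); [rewrite Hmu; unfold Y; ring|unfold Y; ring].
  - intros x _; apply H0.
  - intros m _; apply cexp_exp_sum_decay; apply mu_symbol.
  - intros m _; unfold semi_wave; rewrite Rminus_diag, cexp_0, exp_sum_0; ring.
Qed.

Lemma semi_wave_flux (Phi : nat -> C) (m : nat) : Phi O = 0 -> (1 <= m)%nat ->
  is_derive_from X (fun y => sbar_t (fun k => semi_wave Phi k y) m) X (transparent_op Phi m).
Proof.
  intros HPhi Hm.
  apply (is_derive_from_ext X (fun y => (sbar_fps * (fun k => semi_wave Phi k y))%fps m)); [lra| |].
  { intros y _; symmetry; apply sbar_fps_mul; auto.
    unfold semi_wave; simpl; rewrite HPhi; ring. }
  unfold transparent_op.
  replace (fopp (sbar_fps * (mu * Phi)))%fps with (sbar_fps * fopp (mu * Phi))%fps by ring.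
  apply (is_derive_from_conv X sbar_fps (fun i y => semi_wave Phi i y)); intros i _.
  replace (mu * Phi)%fps with (mu * (fun k => semi_wave Phi k X))%fps.
  - apply semi_wave_derive; lra.
  - f_equal; apply functional_extensionality; intro k.
    unfold semi_wave; rewrite Rminus_diag, cexp_0, exp_sum_0; ring.
Qed.
End SemiDiscrete.

(** The symbol identity tested on a sequence concentrated at level 1, where only mu_0 survives. It
    governs two solutions at the first level where they could differ. *)
Lemma symbol_level (hbar rho B V tau : R) (mu : fps) (y : C) :
  is_symbol hbar rho B V tau mu ->
  (hbar ^ 2 / 2)%R * B * (mu O * mu O * (y / 2)) = V * (y / 2) - Ci * hbar * rho * (y / tau).
Proof.
  intros [_ [_ H]].
  specialize (H (fun k => match k with 1%nat => y | _ => 0 end) 1%nat eq_refl (le_n 1)).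
  unfold sbar_t, dbar_t, fmul in H; simpl in H.
  transitivity ((hbar ^ 2 / 2)%R * B *
      (/ 2 * (mu 0%nat * mu 0%nat) * y +
       fshift (conv sbar_fps (conv mu mu)) 0%nat * 0)).
  - unfold Cdiv; ring.
  - simpl; rewrite H; unfold Cdiv; ring.
Qed.

Section SemiDiscreteUniqueness.
Context (hbar rho B V tau X : R) (mu : fps).
Hypotheses (hbar_pos : (0 < hbar)%R) (B_pos : (0 < B)%R).
Hypothesis mu_symbol : is_symbol hbar rho B V tau mu.

Let a_neq : RtoC (hbar ^ 2 / 2) * B <> 0 := diffusion_neq_0 hbar B hbar_pos B_pos.

(** Once level [m] agrees, the history cancels and the averaged difference W at level [S m]
    satisfies W'' = mu_0^2 W, W(X) = 0 and decay. *)
Lemma SDTBC_solution_unique (Phi : nat -> C) (P Q : nat -> R -> C) :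
  is_SDTBC_solution hbar rho B V tau X Phi P ->
  is_SDTBC_solution hbar rho B V tau X Phi Q ->
  forall (m : nat) (x : R), (X <= x)%R -> P m x = Q m x.
Proof.
  intros [P1 [P2 [P3 P4]]] [Q1 [Q2 [Q3 Q4]]] m.
  induction m as [|m IH]; intros x Hx; [rewrite P2, Q2; auto|].
  assert (Hm : (1 <= S m)%nat) by lia.
  destruct (P1 (S m) Hm) as [DP [D2P HP]].
  destruct (Q1 (S m) Hm) as [DQ [D2Q HQ]].
  set (W := fun y => sbar_t (fun k => P k y) (S m) + - RtoC 1 * sbar_t (fun k => Q k y) (S m)).
  assert (HW : forall y, (X <= y)%R -> W y = (P (S m) y - Q (S m) y) / 2).
  { intros y Hy; unfold W, sbar_t; simpl; rewrite Nat.sub_0_r, IH by exact Hy.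
    unfold Cdiv; ring. }
  assert (H0 : W x = 0).
  { apply (ode_second_order_decaying X (mu O) W (fun y => DP y + - RtoC 1 * DQ y)
      (fun y => D2P y + - RtoC 1 * D2Q y)); [apply mu_symbol| | | | | |exact Hx].
    - intros y Hy; apply is_derive_from_plus; [|apply is_derive_from_scale];
        [apply HP|apply HQ]; exact Hy.
    - intros y Hy; apply is_derive_from_plus; [|apply is_derive_from_scale];
        [apply HP|apply HQ]; exact Hy.
    - intros y Hy; destruct (HP y Hy) as [_ [_ EP]]; destruct (HQ y Hy) as [_ [_ EQ]].
      rewrite HW by exact Hy.
      generalize (symbol_level _ _ _ _ _ _ (P (S m) y - Q (S m) y) mu_symbol); intro E.
      unfold sbar_t, dbar_t in EP, EQ; replace (S m - 1)%nat with m in EP, EQ by lia.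
      rewrite IH in EP by exact Hy.
      match type of E with ?a * ?b = ?c =>
        transitivity (a * b / a); [rewrite E|field; split; intro F; apply a_neq; rewrite F; ring] end.
      transitivity ((hbar ^ 2 / 2)%R * B * (D2P y + - RtoC 1 * D2Q y) / ((hbar ^ 2 / 2)%R * B)).
      { field; split; intro F; apply a_neq; rewrite F; ring. }
      f_equal.
      match type of EP with ?l = ?r + ?v =>
        match type of EQ with ?l' = ?r' + ?v' =>
          transitivity (v - (r + v) - (v' - (r' + v'))); [ring|rewrite <- EP, <- EQ]
        end end.
      unfold Cdiv; ring.
    - rewrite HW, P4, Q4 by (auto; lra); unfold Cdiv; ring.
    - apply filterlim_ext_loc with (fun y => / 2 * (P (S m) y + - RtoC 1 * Q (S m) y)).
      + exists X; intros y Hy; rewrite HW by lra; unfold Cdiv; ring.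
      + replace (RtoC 0) with (/ 2 * (0 + - RtoC 1 * 0)) by ring.
        apply filterlim_Cmult; [apply filterlim_const|].
        apply filterlim_Cplus; [auto|].
        apply filterlim_Cmult; [apply filterlim_const|auto]. }
  rewrite HW in H0 by exact Hx.
  transitivity (Q (S m) x + 2 * ((P (S m) x - Q (S m) x) / 2)); [field|rewrite H0; ring].
Qed.

(** Uniqueness identifies any solution with the explicit wave for x >= X only, which suffices for a
    derivative taken from the half-line. *)
Lemma transparent_op_SDTBC : is_SDTBC_operator hbar rho B V tau X (transparent_op mu).
Proof.
  intros Phi HPhi; split.
  - exists (semi_wave X mu Phi); apply semi_wave_solution; auto.
  - intros Psi HPsi m Hm.
    apply (is_derive_from_ext X (fun y => sbar_t (fun k => semi_wave X mu Phi k y) m)); [lra| |].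
    + intros y Hy; unfold sbar_t.
      assert (E := SDTBC_solution_unique Phi _ _ HPsi
        (semi_wave_solution hbar rho B V tau X mu mu_symbol Phi HPhi)).
      rewrite !E by exact Hy; reflexivity.
    + apply semi_wave_flux; auto.
Qed.
End SemiDiscreteUniqueness.

(** * The mesh problem *)

(** |1 + z|^2 - |1 - z|^2 = 4 Re z: the Cayley transform sends the right half-plane into the unit
    disc. *)
Lemma Cmod_lt_Re_pos (z : C) : (0 < Re z)%R -> (Cmod (1 - z) < Cmod (1 + z))%R.
Proof.
  destruct z as [x y]; unfold Cmod, Re; simpl; intros H.
  apply sqrt_lt_1_alt; split; [|nra].
  rewrite !Rmult_1_r; apply Rplus_le_le_0_compat; apply Rle_0_sqr.
Qed.

(** Coefficients of nu^k Phi carry powers of [k] besides nu_0^k; a ratio [q] slightly above |nu_0|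
    absorbs them. *)
Definition geom_bounded (q : R) (u : nat -> C) : Prop :=
  exists K, (0 <= K)%R /\ forall k, (Cmod (u k) <= K * q ^ k)%R.

Lemma geom_bounded_conv (q : R) (c : fps) (Y : nat -> fps) (m : nat) :
  (forall i, (i <= m)%nat -> geom_bounded q (fun k => Y k i)) ->
  geom_bounded q (fun k => conv c (Y k) m).
Proof.
  assert (P : forall a i, geom_bounded q (fun k => Y k i) ->
    geom_bounded q (fun k => a * Y k i)).
  { intros a i [K [HK H]]; exists (Cmod a * K)%R; split.
    - apply Rmult_le_pos; auto using Cmod_ge_0.
    - intro k; rewrite Cmod_mult, Rmult_assoc.
      apply Rmult_le_compat_l; auto using Cmod_ge_0. }
  revert c; induction m as [|m IH]; intros c H; simpl; [apply P, H; lia|].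
  destruct (P (c O) (S m)) as [K1 [HK1 H1]]; [apply H; lia|].
  destruct (IH (fshift c)) as [K2 [HK2 H2]]; [intros; apply H; lia|].
  exists (K1 + K2)%R; split; [lra|]; intro k.
  eapply Rle_trans; [apply Cmod_triangle|]; rewrite Rmult_plus_distr_r.
  apply Rplus_le_compat; auto.
Qed.

Lemma geom_bounded_rec (q : R) (nu : C) (u g : nat -> C) :
  (Cmod nu < q)%R -> geom_bounded q g ->
  (forall k, u (S k) = nu * u k + g k) -> geom_bounded q u.
Proof.
  intros Hq [K [HK Hg]] Hu.
  assert (Hnu := Cmod_ge_0 nu).
  (* Chosen so that |nu| M + K <= q M, which is what the induction step needs. *)
  set (M := (Cmod (u O) + K / (q - Cmod nu))%R).
  assert (HM1 : (0 <= K / (q - Cmod nu))%R)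
    by (apply Rmult_le_pos; [exact HK|apply Rlt_le, Rinv_0_lt_compat; lra]).
  assert (HM0 := Cmod_ge_0 (u O)).
  exists M; split; [unfold M; lra|]; intro k; induction k as [|k IH].
  { simpl; unfold M; lra. }
  rewrite Hu; eapply Rle_trans; [apply Cmod_triangle|]; rewrite Cmod_mult.
  assert (Hqk : (0 <= q ^ k)%R) by (apply pow_le; lra).
  assert (HMK : (K <= M * (q - Cmod nu))%R).
  { unfold M; rewrite Rmult_plus_distr_r.
    replace (K / (q - Cmod nu) * (q - Cmod nu))%R with K by (field; lra).
    assert (0 <= Cmod (u O) * (q - Cmod nu))%R by (apply Rmult_le_pos; lra); lra. }
  apply Rle_trans with (Cmod nu * (M * q ^ k) + M * (q - Cmod nu) * q ^ k)%R.
  - apply Rplus_le_compat; [apply Rmult_le_compat_l; auto|].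
    eapply Rle_trans; [apply Hg|]; apply Rmult_le_compat_r; auto.
  - apply Req_le; simpl; ring.
Qed.

(** In [k], coefficient [m] obeys a first-order recurrence with factor nu_0, forced by lower
    coefficients only; the strict gap |nu_0| < q keeps the same ratio at every [m]. *)
Lemma fpow_mul_geom_bounded (q : R) (nu Phi : fps) (m : nat) :
  (Cmod (nu O) < q)%R -> geom_bounded q (fun k => fpow_mul nu k Phi m).
Proof.
  intros Hq; induction m as [m IH] using (well_founded_induction Nat.lt_wf_0).
  destruct m as [|m].
  - apply (geom_bounded_rec q (nu O) _ (fun _ => 0)); [exact Hq| |].
    + exists 0%R; split; [lra|]; intro k; rewrite Cmod_0; lra.
    + intro k; simpl; unfold fmul; simpl; ring.
  - apply (geom_bounded_rec q (nu O) _ (fun k => conv (fshift nu) (fpow_mul nu k Phi) m));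
      [exact Hq| |reflexivity].
    apply geom_bounded_conv; intros i Hi; apply IH; lia.
Qed.

Lemma geom_bounded_square_summable (q : R) (u : nat -> C) :
  (0 <= q < 1)%R -> geom_bounded q u -> ex_series (fun k => (Cmod (u k) ^ 2)%R).
Proof.
  intros Hq [K [HK H]].
  apply (ex_series_le (K := R_AbsRing) (V := R_CompleteNormedModule) _
    (fun k => (K ^ 2 * (q ^ 2) ^ k)%R)).
  - intro k; change (norm (Cmod (u k) ^ 2)%R) with (Rabs (Cmod (u k) ^ 2)).
    rewrite Rabs_pos_eq by apply pow2_ge_0.
    replace (K ^ 2 * (q ^ 2) ^ k)%R with ((K * q ^ k) ^ 2)%R
      by (rewrite Rpow_mult_distr, <- !pow_mult, (Nat.mul_comm k); reflexivity).
    apply pow_incr; split; auto using Cmod_ge_0.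
  - apply (ex_series_scal (V := R_NormedModule) (K ^ 2)%R), ex_series_geom.
    rewrite Rabs_pos_eq by apply pow2_ge_0; simpl; nra.
Qed.

Lemma square_summable_vanish (u : nat -> C) :
  ex_series (fun k => (Cmod (u k) ^ 2)%R) -> filterlim u eventually (locally (0 : C)).
Proof.
  intros H; apply ex_series_lim_0 in H.
  apply filterlim_C_bound with (fun k => sqrt (Cmod (u k) ^ 2)).
  - apply filter_forall; intro k; rewrite sqrt_pow2 by apply Cmod_ge_0; apply Rle_refl.
  - rewrite <- sqrt_0; apply (is_lim_seq_continuous sqrt); [|exact H].
    apply continuity_pt_sqrt; lra.
Qed.

(* With U k := (1 + z) e (k + 1) - (1 - z) e k, the recurrence reads
   (1 - z) U (k + 1) = (1 + z) U k, so |U| cannot decrease. *)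
Lemma recurrence_decaying_zero (z : C) (e : nat -> C) :
  (0 < Re z)%R -> 1 - z <> 0 ->
  (forall k, e (k + 2)%nat - 2 * e (k + 1)%nat + e k
             = z * z * (e (k + 2)%nat + 2 * e (k + 1)%nat + e k)) ->
  filterlim e eventually (locally (0 : C)) -> e 1%nat = 0 ->
  forall k, e k = 0.
Proof.
  intros Hz Hz1 Hrec Hlim He1.
  assert (Hlt := Cmod_lt_Re_pos z Hz).
  assert (Hpos := Cmod_gt_0 (1 - z)); apply Hpos in Hz1 as Hz1'; clear Hpos.
  assert (Hz2 : 1 + z <> 0) by (intro E; rewrite E, Cmod_0 in Hlt; lra).
  set (U := fun k => (1 + z) * e (k + 1)%nat + - (1 - z) * e k).
  assert (HU : forall k, (1 - z) * U (S k) = (1 + z) * U k).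
  { intro k; unfold U; specialize (Hrec k).
    replace (S k + 1)%nat with (k + 2)%nat by lia.
    replace (S k) with (k + 1)%nat by lia.
    match type of Hrec with ?l = ?r =>
      transitivity ((1 + z) * ((1 + z) * e (k + 1)%nat + - (1 - z) * e k) + (l - r));
      [ring|rewrite Hrec; ring] end. }
  assert (HUm : forall k n, (Cmod (U k) <= Cmod (U (n + k)%nat))%R).
  { intros k n; induction n as [|n IH]; [apply Rle_refl|].
    eapply Rle_trans; [exact IH|].
    change (S n + k)%nat with (S (n + k)).
    apply Rmult_le_reg_l with (1 := Hz1').
    rewrite <- (Cmod_mult (1 - z) (U (S (n + k)))), HU, Cmod_mult.
    apply Rmult_le_compat_r; [apply Cmod_ge_0|lra]. }
  assert (HUlim : filterlim (fun n => Cmod (U n)) eventually (locally 0%R)).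
  { apply filterlim_Cmod; replace (RtoC 0) with ((1 + z) * 0 + - (1 - z) * 0) by ring.
    apply filterlim_Cplus; (apply filterlim_Cmult; [apply filterlim_const|]); [|exact Hlim].
    apply (filterlim_comp _ _ _ (fun k => (k + 1)%nat) e _ eventually); [|exact Hlim].
    intros P [M HM]; exists M; intros n Hn; apply HM; lia. }
  assert (HU0 : forall k, U k = 0).
  { intro k; apply Cmod_eq_0, Rle_antisym; [|apply Cmod_ge_0].
    change (Rbar_le (Cmod (U k)) 0).
    apply (is_lim_seq_le (fun _ => Cmod (U k)) (fun n => Cmod (U (n + k)%nat)));
      [intro n; apply HUm|apply is_lim_seq_const|].
    apply (is_lim_seq_incr_n (fun n => Cmod (U n)) k); exact HUlim. }
  assert (Hstep : forall k, e (S k) = 0).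
  { intro k; induction k as [|k IH]; [exact He1|].
    specialize (HU0 (S k)); unfold U in HU0; rewrite IH in HU0.
    replace (S k + 1)%nat with (S (S k)) in HU0 by lia.
    transitivity (((1 + z) * e (S (S k)) + - (1 - z) * 0) / (1 + z));
      [field; exact Hz2|rewrite HU0; field; exact Hz2]. }
  (* Index 0 lies before the prescribed value [e 1]; recovering it from U_0 = 0 requires 1 - z to be
     nonzero. *)
  intros [|k]; [|apply Hstep].
  specialize (HU0 O); unfold U in HU0; simpl in HU0; rewrite He1 in HU0.
  transitivity (- ((1 + z) * 0 + - (1 - z) * e O) / (1 - z));
    [field; exact Hz1|rewrite HU0; field; exact Hz1].
Qed.

Section Discrete.
Context (hbar rho B V tau h : R) (J : nat) (mu : fps).
Hypotheses (h_pos : (0 < h)%R) (hbar_pos : (0 < hbar)%R) (B_pos : (0 < B)%R)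
  (J_pos : (1 <= J)%nat).
Hypothesis mu_symbol : is_symbol hbar rho B V tau mu.

Let a_neq : RtoC (hbar ^ 2 / 2) * B <> 0 := diffusion_neq_0 hbar B hbar_pos B_pos.

Let h_neq : RtoC h <> 0.
Proof. apply RtoC_neq_0; lra. Qed.

Let z : fps := (fcst (h / 2)%R * mu)%fps.

Let z_0 : z O = (h / 2)%R * mu O.
Proof. reflexivity. Qed.

Let z_Re : (0 < Re (z O))%R.
Proof.
  rewrite z_0; destruct mu_symbol as [Hmu _]; unfold Re in *; simpl.
  rewrite Rmult_0_l, Rminus_0_r; apply Rmult_lt_0_compat; lra.
Qed.

(** Otherwise mu_0 = 2 / h would be real, against Im (mu_0^2) being nonzero. *)
Let one_minus_z : 1 - z O <> 0.
Proof.
  intro E; destruct mu_symbol as [_ [Hmu _]]; apply Hmu.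
  assert (H : mu O = (2 / h)%R).
  { transitivity ((2 / h)%R * ((h / 2)%R * mu O)).
    - rewrite Cmult_assoc, <- RtoC_mult.
      replace (2 / h * (h / 2))%R with 1%R by (field; lra); ring.
    - rewrite <- z_0; transitivity ((2 / h)%R * (1 - (1 - z O))); [ring|rewrite E; ring]. }
  rewrite H; unfold Im; simpl; ring.
Qed.

Let one_plus_z : 1 + z O <> 0.
Proof.
  intro E; assert (H := Cmod_lt_Re_pos _ z_Re); rewrite E, Cmod_0 in H.
  assert (H' := Cmod_ge_0 (1 - z O)); lra.
Qed.

Lemma symbol_step (Y : fps) (m : nat) : Y O = 0 -> (1 <= m)%nat ->
  (hbar ^ 2 / 2)%R * B * (sbar_fps * z * z * Y)%fps m
  = (h / 2)%R * (h / 2)%R * (V * sbar_t Y m - Ci * hbar * rho * dbar_t tau Y m).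
Proof.
  intros HY Hm.
  replace (sbar_fps * z * z * Y)%fps with
    (fcst (h / 2)%R * (fcst (h / 2)%R * (sbar_fps * (mu * mu) * Y)))%fps
    by (unfold z; ring).
  rewrite !fcst_mul.
  destruct mu_symbol as [_ [_ <-]]; auto; ring.
Qed.

(** For this weight the average is a two-point mean applied twice, which is why the scheme
    factors. *)
Lemma C_av_quarter (W : nat -> C) (j : nat) :
  C_av (1 / 4) W j = (W (j + 1)%nat + 2 * W j + W (j - 1)%nat) / 4.
Proof.
  unfold C_av.
  replace (1 - 2 * (1 / 4))%R with (2 / 4)%R by field.
  rewrite !RtoC_div by lra; field.
Qed.

(** Each premise is the trapezoidal step (A - Bc) / h = - mu (A + Bc) / 2 for D Psi = - mu Psi. Two
    consecutive steps give A - 2 Bc + D = z^2 (A + 2 Bc + D), which the symbol turns into the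
    scheme. *)
Lemma box_scheme (A Bc D : fps) (m : nat) :
  ((1 + z) * A = (1 - z) * Bc)%fps -> ((1 + z) * Bc = (1 - z) * D)%fps ->
  A O = 0 -> Bc O = 0 -> D O = 0 -> (1 <= m)%nat ->
  Ci * hbar * rho * ((dbar_t tau A m + 2 * dbar_t tau Bc m + dbar_t tau D m) / 4)
  = - (hbar ^ 2 / 2)%R * B * ((sbar_t A m - 2 * sbar_t Bc m + sbar_t D m) / (h ^ 2)%R)
    + V * ((sbar_t A m + 2 * sbar_t Bc m + sbar_t D m) / 4).
Proof.
  intros E1 E2 HA HB HD Hm.
  assert (E : (sbar_fps * A - (1 + 1) * (sbar_fps * Bc) + sbar_fps * D
     = sbar_fps * z * z * A + (1 + 1) * (sbar_fps * z * z * Bc) + sbar_fps * z * z * D)%fps).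
  { transitivity (sbar_fps * ((1 - z) * ((1 + z) * A - (1 - z) * Bc)
      - (1 + z) * ((1 + z) * Bc - (1 - z) * D)) + (sbar_fps * z * z * A
      + (1 + 1) * (sbar_fps * z * z * Bc) + sbar_fps * z * z * D))%fps;
      [ring|rewrite E1, E2; ring]. }
  replace (1 + 1)%fps with (fcst 2) in E.
  2:{ apply functional_extensionality; intros [|n]; unfold fadd; simpl; ring. }
  apply (f_equal (fun f : fps => f m)) in E.
  unfold fadd, fsub in E; rewrite !fcst_mul in E.
  rewrite <- !sbar_fps_mul in E by auto.
  set (S := sbar_t A m - 2 * sbar_t Bc m + sbar_t D m) in *.
  assert (E' : (hbar ^ 2 / 2)%R * B * S = h * h / 4 *
    (V * (sbar_t A m + 2 * sbar_t Bc m + sbar_t D m)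
     - Ci * hbar * rho * (dbar_t tau A m + 2 * dbar_t tau Bc m + dbar_t tau D m))).
  { rewrite E.
    transitivity ((hbar ^ 2 / 2)%R * B * (sbar_fps * z * z * A)%fps m
      + 2 * ((hbar ^ 2 / 2)%R * B * (sbar_fps * z * z * Bc)%fps m)
      + (hbar ^ 2 / 2)%R * B * (sbar_fps * z * z * D)%fps m); [ring|].
    rewrite !symbol_step, (RtoC_div h 2) by auto; field. }
  transitivity (- ((hbar ^ 2 / 2)%R * B * S) / (h * h)
    + V * ((sbar_t A m + 2 * sbar_t Bc m + sbar_t D m) / 4)).
  - rewrite E'; field; exact h_neq.
  - rewrite RtoC_pow; field; exact h_neq.
Qed.

(** The [s_minus] correction amounts to z^2 (Bc + D) = - z (Bc - D). Added to Bc - D = - z (Bc + D)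
    it cancels the inner node and leaves - 2 z Bc = - h mu Bc. *)
Lemma box_flux (Bc D : fps) (m : nat) :
  ((1 + z) * Bc = (1 - z) * D)%fps ->
  Bc O = 0 -> D O = 0 -> (1 <= m)%nat ->
  (hbar ^ 2 / 2)%R * B * ((sbar_t Bc m - sbar_t D m) / h)
  - h * ((Ci * hbar * rho * (dbar_t tau Bc m + dbar_t tau D m)
          - V * (sbar_t Bc m + sbar_t D m)) / 4)
  = (hbar ^ 2 / 2)%R * B * transparent_op mu Bc m.
Proof.
  intros E2 HB HD Hm.
  assert (E : (sbar_fps * Bc - sbar_fps * D + sbar_fps * z * z * Bc + sbar_fps * z * z * D
     = fcst h * fopp (sbar_fps * (mu * Bc)))%fps).
  { replace (fcst h * fopp (sbar_fps * (mu * Bc)))%fps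
      with (fopp (sbar_fps * z * Bc) + fopp (sbar_fps * z * Bc))%fps.
    2:{ transitivity (fopp ((fcst (h / 2)%R + fcst (h / 2)%R) * (sbar_fps * (mu * Bc))))%fps;
          [unfold z; ring|].
        replace (fcst (h / 2)%R + fcst (h / 2)%R)%fps with (fcst h); [ring|].
        apply functional_extensionality; intros [|n]; unfold fadd; simpl; [|ring].
        rewrite RtoC_div by lra; field. }
    transitivity (sbar_fps * (1 + z) * ((1 + z) * Bc - (1 - z) * D)
      + (fopp (sbar_fps * z * Bc) + fopp (sbar_fps * z * Bc)))%fps;
      [ring|rewrite E2; ring]. }
  apply (f_equal (fun f : fps => f m)) in E.
  unfold fadd, fsub in E; rewrite fcst_mul in E.
  rewrite <- !sbar_fps_mul in E by auto.
  change (fopp (sbar_fps * (mu * Bc))%fps m) with (transparent_op mu Bc m) in E.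
  transitivity ((hbar ^ 2 / 2)%R * B * (h * transparent_op mu Bc m) / h);
    [rewrite <- E|field; exact h_neq].
  transitivity (((hbar ^ 2 / 2)%R * B * (sbar_t Bc m - sbar_t D m)
    + (hbar ^ 2 / 2)%R * B * (sbar_fps * z * z * Bc)%fps m
    + (hbar ^ 2 / 2)%R * B * (sbar_fps * z * z * D)%fps m) / h);
    [|field; exact h_neq].
  rewrite !symbol_step, (RtoC_div h 2) by auto; field; exact h_neq.
Qed.

Lemma mesh_multiplier : exists nu eta : fps,
  ((1 + z) * nu = 1 - z)%fps /\ ((1 + z) = (1 - z) * eta)%fps /\ (nu * eta = 1)%fps /\
  (Cmod (nu O) < 1)%R.
Proof.
  destruct (fps_inverse (1 + z)%fps one_plus_z) as [p Hp].
  destruct (fps_inverse (1 - z)%fps one_minus_z) as [q Hq].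
  exists ((1 - z) * p)%fps, ((1 + z) * q)%fps; repeat split.
  - transitivity ((1 - z) * ((1 + z) * p))%fps; [ring|rewrite Hp; ring].
  - transitivity ((1 + z) * ((1 - z) * q))%fps; [rewrite Hq; ring|ring].
  - transitivity (((1 - z) * q) * ((1 + z) * p))%fps; [ring|rewrite Hp, Hq; ring].
  - assert (E : (1 + z O) * p O = 1) by exact (f_equal (fun f : fps => f O) Hp).
    change (Cmod ((1 - z O) * p O) < 1)%R.
    rewrite Cmod_mult.
    assert (F : (Cmod (1 + z O) * Cmod (p O) = 1)%R)
      by (rewrite <- Cmod_mult, E; apply Cmod_1).
    assert (L := Cmod_lt_Re_pos _ z_Re).
    assert (H1 := Cmod_ge_0 (p O)); assert (H2 := Cmod_ge_0 (1 - z O)).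
    eapply Rlt_le_trans; [|apply Req_le, F]; apply Rmult_lt_compat_r; [|exact L].
    destruct H1 as [H1|H1]; [exact H1|rewrite <- H1, Rmult_0_r in F; lra].
Qed.

Lemma DTBC_solution_exists (Phi : nat -> C) : Phi O = 0 ->
  exists Psi, is_DTBC_solution hbar rho B V tau h (1 / 4) J Phi Psi /\
    forall m, (1 <= m)%nat ->
      DTBC_flux hbar rho B V tau h (1 / 4) J Psi m
      = (hbar ^ 2 / 2)%R * B * transparent_op mu Phi m.
Proof.
  intros HPhi.
  destruct mesh_multiplier as [nu [eta [Hnu [Heta [Hne Hlt]]]]].
  (* The wave starts at node J - 1, which both the scheme at [J] and the flux involve; the amplitude
     eta Phi, with eta = 1 / nu, makes the value at [J] equal to Phi. *)
  set (Y := fun j => fpow_mul nu (j - (J - 1)) (eta * Phi)%fps).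
  assert (Hstep : forall j, (J - 1 <= j)%nat -> ((1 + z) * Y (j + 1)%nat = (1 - z) * Y j)%fps).
  { intros j Hj; unfold Y; replace (j + 1 - (J - 1))%nat with (S (j - (J - 1))) by lia.
    cbn [fpow_mul]; rewrite <- Hnu; ring. }
  assert (HYJ : Y J = Phi).
  { unfold Y; replace (J - (J - 1))%nat with 1%nat by lia; cbn [fpow_mul].
    transitivity ((nu * eta) * Phi : fps)%fps; [ring|rewrite Hne; ring]. }
  assert (HY0 : forall j, Y j O = 0).
  { intro j; unfold Y; induction (j - (J - 1))%nat as [|k IH].
    - change (eta O * Phi O = 0); rewrite HPhi; ring.
    - change (nu O * fpow_mul nu k (eta * Phi)%fps O = 0); rewrite IH; ring. }
  exists (fun m j => Y j m); split; [repeat split|].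
  - intros m j Hm Hj dPsi sPsi.
    rewrite !C_av_quarter.
    apply (box_scheme (Y (j + 1)%nat) (Y j) (Y (j - 1)%nat)); auto.
    + apply Hstep; lia.
    + rewrite <- Hstep by lia; do 2 f_equal; lia.
  - intros j _; apply HY0.
  - intros m _; rewrite HYJ; reflexivity.
  - intro m.
    (* Strictly between |nu_0| and 1: room for the powers of [k], yet still summable. *)
    set (q := ((Cmod (nu O) + 1) / 2)%R).
    assert (Hq0 := Cmod_ge_0 (nu O)).
    apply geom_bounded_square_summable with q; [unfold q; lra|].
    destruct (fpow_mul_geom_bounded q nu (eta * Phi)%fps m) as [K [HK H]]; [unfold q; lra|].
    exists (K * q)%R; split; [apply Rmult_le_pos; unfold q; lra|].
    intro k; unfold Y; replace (J + k - (J - 1))%nat with (S k) by lia.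
    rewrite Rmult_assoc; apply H.
  - intros m Hm.
    rewrite <- HYJ at 1.
    rewrite <- (box_flux (Y J) (Y (J - 1)%nat) m); auto.
    + unfold DTBC_flux, s_minus; cbv zeta.
      change (fun k : nat => Y J k) with (Y J).
      change (fun k : nat => Y (J - 1)%nat k) with (Y (J - 1)%nat).
      replace (1 / 2 - 1 / 4)%R with (1 / 4)%R by field.
      rewrite (RtoC_div 1 4) by lra; field; exact h_neq.
    + rewrite <- Hstep by lia; do 2 f_equal; lia.
Qed.

Lemma DTBC_solution_unique (Phi : nat -> C) (P Q : nat -> nat -> C) :
  is_DTBC_solution hbar rho B V tau h (1 / 4) J Phi P ->
  is_DTBC_solution hbar rho B V tau h (1 / 4) J Phi Q ->
  forall m j : nat, (J - 1 <= j)%nat -> P m j = Q m j.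
Proof.
  intros [P1 [P2 [P3 P4]]] [Q1 [Q2 [Q3 Q4]]] m.
  induction m as [|m IH]; intros j Hj; [rewrite P2, Q2; auto|].
  assert (Hm : (1 <= S m)%nat) by lia.
  (* Indexing starts at node J - 1, so the prescribed boundary value is [e 1]. *)
  set (e := fun k => P (S m) (J - 1 + k)%nat + - RtoC 1 * Q (S m) (J - 1 + k)%nat).
  assert (He : e (j - (J - 1))%nat = 0).
  { apply (recurrence_decaying_zero (z O) e z_Re one_minus_z).
    - intro k.
      assert (EP := P1 (S m) (J + k)%nat Hm ltac:(lia)).
      assert (EQ := Q1 (S m) (J + k)%nat Hm ltac:(lia)).
      cbv zeta in EP, EQ; rewrite !C_av_quarter in EP, EQ.
      unfold dbar_t, sbar_t in EP, EQ.
      replace (S m - 1)%nat with m in EP, EQ by lia.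
      rewrite !IH in EP by lia.
      unfold e.
      replace (J - 1 + (k + 2))%nat with (J + k + 1)%nat by lia.
      replace (J - 1 + (k + 1))%nat with (J + k)%nat by lia.
      replace (J - 1 + k)%nat with (J + k - 1)%nat by lia.
      set (p2 := P (S m) (J + k + 1)%nat) in *; set (p1 := P (S m) (J + k)%nat) in *;
      set (p0 := P (S m) (J + k - 1)%nat) in *;
      set (q2 := Q (S m) (J + k + 1)%nat) in *; set (q1 := Q (S m) (J + k)%nat) in *;
      set (q0 := Q (S m) (J + k - 1)%nat) in *.
      set (y := ((p2 - q2) + 2 * (p1 - q1) + (p0 - q0)) / 4).
      assert (E := symbol_level _ _ _ _ _ _ y mu_symbol).
      set (a := (hbar ^ 2 / 2)%R * B) in *.
      set (d := (p2 - q2) - 2 * (p1 - q1) + (p0 - q0)).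
      assert (F : a * (d / 2 / (h ^ 2)%R) = V * (y / 2) - Ci * hbar * rho * (y / tau)).
      { match type of EP with ?l = ?r + ?v =>
          match type of EQ with ?l' = ?r' + ?v' =>
            transitivity (v - (r + v) - (v' - (r' + v')));
              [unfold a, d, Cdiv; ring|rewrite <- EP, <- EQ; unfold y, Cdiv; ring]
          end end. }
      rewrite <- E in F.
      transitivity d; [unfold d; ring|].
      transitivity (a * (d / 2 / (h ^ 2)%R) * (2 * (h * h)) / a).
      { rewrite RtoC_pow; field; split; auto. }
      rewrite F, z_0, (RtoC_div h 2) by lra.
      transitivity (mu O * mu O * h * h * y); [field; exact a_neq|].
      unfold y; field.
    - unfold e.
      assert (L : forall u : nat -> C, ex_series (fun k => (Cmod (u (J + k)%nat) ^ 2)%R) ->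
        filterlim (fun k => u (J - 1 + k)%nat) eventually (locally (0 : C))).
      { intros u Hu; apply square_summable_vanish in Hu.
        intros Pr HPr; destruct (Hu Pr HPr) as [M HM].
        exists (S M); intros n Hn.
        replace (J - 1 + n)%nat with (J + (n - 1))%nat by lia; apply HM; lia. }
      replace (RtoC 0) with (0 + - RtoC 1 * 0) by ring.
      apply filterlim_Cplus; [apply (L (P (S m))), P4|].
      apply filterlim_Cmult; [apply filterlim_const|apply (L (Q (S m))), Q4].
    - unfold e; replace (J - 1 + 1)%nat with J by lia; rewrite P3, Q3 by lia; ring. }
  unfold e in He; replace (J - 1 + (j - (J - 1)))%nat with j in He by lia.
  transitivity (Q (S m) j + (P (S m) j + - RtoC 1 * Q (S m) j)); [ring|rewrite He; ring].
Qed.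

Lemma transparent_op_DTBC :
  is_DTBC_operator hbar rho B V tau h (1 / 4) J (transparent_op mu).
Proof.
  intros Phi HPhi.
  destruct (DTBC_solution_exists Phi HPhi) as [Psi [HPsi Hflux]].
  split; [exists Psi; exact HPsi|].
  intros Q HQ m Hm.
  replace (DTBC_flux hbar rho B V tau h (1 / 4) J Q m)
    with (DTBC_flux hbar rho B V tau h (1 / 4) J Psi m).
  - rewrite Hflux by exact Hm.
    rewrite Cmult_assoc, <- !RtoC_mult.
    replace (2 / (hbar ^ 2 * B) * (hbar ^ 2 / 2 * B))%R with 1%R by (field; lra).
    ring.
  (* The flux reads only nodes J - 1 and [J] at levels m - 1 and [m], all covered by uniqueness. *)
  - assert (U := DTBC_solution_unique Phi Psi Q HPsi HQ).
    unfold DTBC_flux, s_minus, dbar_t, sbar_t; cbv zeta.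
    rewrite !U by lia; reflexivity.
Qed.
End Discrete.

(** * Coincidence of the two operators *)

Theorem proposition2 (h tau hbar rho B V X : R) (J : nat)
    (hh : (0 < h)%R) (htau : (0 < tau)%R) (hhbar : (0 < hbar)%R)
    (hrho : (0 < rho)%R) (hB : (0 < B)%R) (hJ : (1 <= J)%nat) :
  (exists S_D, is_SDTBC_operator hbar rho B V tau X S_D) /\
  (exists S_ref, is_DTBC_operator hbar rho B V tau h (1 / 4)%R J S_ref) /\
  (forall S_D S_ref : (nat -> C) -> nat -> C,
     is_SDTBC_operator hbar rho B V tau X S_D ->
     is_DTBC_operator hbar rho B V tau h (1 / 4)%R J S_ref ->
     forall Phi : nat -> C, Phi 0%nat = RtoC 0 ->
     forall m : nat, (1 <= m)%nat -> S_D Phi m = S_ref Phi m).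
Proof.
  destruct (symbol_exists hbar rho B V tau htau hhbar hrho hB) as [mu Hmu].
  assert (HS : is_SDTBC_operator hbar rho B V tau X (transparent_op mu))
    by (apply transparent_op_SDTBC; auto).
  assert (HD : is_DTBC_operator hbar rho B V tau h (1 / 4) J (transparent_op mu))
    by (apply transparent_op_DTBC; auto).
  split; [eauto|split; [eauto|]].
  intros S_D S_ref HSD HSref Phi HPhi m Hm.
  (* Any admissible operator is pinned down by evaluating it on one existing solution: by uniqueness
     of the derivative at [X], respectively by the flux formula. *)
  transitivity (transparent_op mu Phi m).
  - destruct (HS Phi HPhi) as [[Psi HPsi] Hflux].
    destruct (HSD Phi HPhi) as [_ Hflux'].
    apply (is_derive_from_unique X (fun y => sbar_t (fun k => Psi k y) m) X);
      [apply Rle_refl|apply Hflux'|apply Hflux]; auto.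
  - destruct (HD Phi HPhi) as [[Psi HPsi] Hflux].
    destruct (HSref Phi HPhi) as [_ Hflux'].
    rewrite (Hflux Psi HPsi m Hm), (Hflux' Psi HPsi m Hm); reflexivity.
Qed.
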